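(* Let $f\in\mathcal C^2(\mathbb R)$ be such that $\{u\in\mathbb R\,|\,f''(u)\ne0\}$ is dense in $\mathbb R$, and let $L,M,T>0$. Let $(S_t)_{t\ge0}$ be the semigroup of entropy admissible weak solutions of $u_t+f(u)_x=0$, let $$\mathcal U_{[L,M]}=\{u_0\in\mathbf L^\infty(\mathbb R)\;|\;\mathrm{Supp}(u_0)\subset[-L,L],\ \|u_0\|_{\mathbf L^\infty(\mathbb R)}\le M\},\qquad f'_M=\sup_{|v|\le M}|f'(v)|,$$ and let $\Psi$ (depending on $f$ and $M$) and the constant $\gamma_{[L,M]}$ (depending only on $L,M,f$) be as defined in the context. Then for every $\varepsilon>0$ sufficiently small, $$\mathcal H_\varepsilon\left(S_T(\mathcal U_{[L,M]})\,\Big|\,\mathbf L^1(\mathbb R)\right)\le\log_2\left(\frac{16M(L+T f'_M)}{\varepsilon}+1\right)+2\left[3\log_25+\log_2(5e)\right]\cdot\frac{\gamma_{[L,M]}\left(1+\frac1T\right)}{\Psi\left(\frac{\varepsilon}{4L+4T f'_M}\right)}.$$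
   Context: $\mathcal H_\varepsilon(K|X)=\log_2\mathcal N_\varepsilon(K|X)$, where $\mathcal N_\varepsilon(K|X)$ is the minimal number of open balls of radius $\varepsilon$ with centers in the metric space $X$ needed to cover $K\subseteq X$. $\mathrm{Supp}(u)$ is the essential support. For $u_0\in\mathbf L^1(\mathbb R)\cap\mathbf L^\infty(\mathbb R)$, $S_tu_0=u(t,\cdot)$ denotes the unique entropy admissible (Kruzhkov) weak solution at time $t$ of the Cauchy problem $u_t(t,x)+f(u(t,x))_x=0$ on $(0,\infty)\times\mathbb R$, $u(0,\cdot)=u_0$; $(S_t)$ is an $\mathbf L^1$-contractive semigroup. The function $\Psi$: for $h\in[0,2M]$ let $$\mathfrak d(h)=\min_{a\in[-M,M-h]}\ \inf_{g\in\mathcal A_{[a,a+h]}}\|f-g\|_{\mathbf L^\infty([a,a+h])},$$ where $\mathcal A_{[a,a+h]}$ is the set of affine functions on $[a,a+h]$. Let $\Phi$ be the convex envelope of $\mathfrak d$, i.e. $\Phi=\sup_{\varphi\in\mathcal G}\varphi$, where $\mathcal G$ is the set of convex $\varphi:[0,+\infty)\to[0,+\infty)$ with $\varphi(0)=0$ and $\varphi\le\mathfrak d$ (on $[0,2M]$). Set $\Psi(x)=\Phi(x/2)\cdot x$; only values at arguments where this is finite (in particular $x\in[0,4M]$) are relevant. $\Psi$-total variation over $\mathbb R$: $TV^\Psi(g,\mathbb R)=\sup\sum_{i=0}^{n-1}\Psi(|g(x_{i+1})-g(x_i)|)$, the supremum being over all $n$ and all $x_0<x_1<\dots<x_n$ in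 $\mathbb R$. The constant $\gamma_{[L,M]}>0$ is a constant depending only on $L,M$ and $f$ such that for all $T>0$ and all $u_0\in\mathcal U_{[L,M]}$, $S_Tu_0$ (a suitable representative) satisfies $TV^\Psi(S_Tu_0,\mathbb R)\le\gamma_{[L,M]}(1+\frac1T)$. Such a constant exists by a known regularity theorem of Marconi for scalar conservation laws. ''Sufficiently small'' means $\varepsilon\le\varepsilon_0$ for some $\varepsilon_0>0$ that may depend on $L,M,T,f$. *)

(* Defs.v *)
From HB Require Import structures.
From mathcomp Require Export all_boot all_order all_algebra.
From mathcomp Require Export all_classical all_reals all_analysis.
Export Order.TTheory GRing.Theory Num.Theory.
Export numFieldNormedType.Exports.

Set Implicit Arguments.
Unset Strict Implicit.
Unset Printing Implicit Defensive.

Local Open Scope ring_scope.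
Local Open Scope classical_set_scope.

Definition log2 {R : realType} (x : R) : R := ln x / ln 2.

Definition C2_function {R : realType} (f : R -> R) : Prop :=
  [/\ forall x : R, derivable f x 1,
      forall x : R, derivable f^`() x 1
    & continuous f^`()^`()].

(* Value +oo when no finite family of balls covers K. *)
Definition covering_number {R : realType} {T : Type} (X : set T)
    (d : T -> T -> \bar R) (K : set T) (eps : R) : \bar R :=
  ereal_inf [set n%:R%:E | n in [set n : nat | exists c : 'I_n -> T,
    (forall i, X (c i)) /\
    K `<=` \bigcup_i [set y | X y /\ (d (c i) y < eps%:E)%E]]].

Definition metric_entropy {R : realType} {T : Type} (X : set T)
    (d : T -> T -> \bar R) (K : set T) (eps : R) : \bar R :=
  (lne (covering_number X d K eps) / (ln 2)%:E)%E.

(* L^1(R) is handled through representatives: d_L1 is a pseudometric whose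
   zero-distance classes are the a.e. classes. *)
Definition L1 {R : realType} : set (R -> R) :=
  [set g | g \in Lfun (@lebesgue_measure R) 1%E].

Definition Linfty {R : realType} : set (R -> R) :=
  [set g | g \in Lfun (@lebesgue_measure R) +oo%E].

Definition norm_Linfty {R : realType} (g : R -> R) : \bar R :=
  ('N[@lebesgue_measure R]_+oo[EFin \o g])%E.

Definition d_L1 {R : realType} (g h : R -> R) : \bar R :=
  ('N[@lebesgue_measure R]_1[EFin \o (g \- h)%R])%E.

(* Complement of the largest open set on which g vanishes almost everywhere. *)
Definition ess_support {R : realType} (g : R -> R) : set R :=
  ~` \bigcup_(O in [set O : set R | open O /\
        {ae @lebesgue_measure R, forall x, O x -> g x = 0}]) O.

Definition initial_data {R : realType} (L M : R) : set (R -> R) :=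
  [set u0 | [/\ Linfty u0, ess_support u0 `<=` `[- L, L]
              & (norm_Linfty u0 <= M%:E)%E]].

Definition max_speed {R : realType} (f : R -> R) (M : R) : R :=
  sup [set `|f^`() v| | v in `[- M, M]].

Definition dt {R : realType} (phi : R -> R -> R) (t x : R) : R :=
  derive1 (fun s => phi s x) t.

Definition dx {R : realType} (phi : R -> R -> R) (t x : R) : R :=
  derive1 (phi t) x.

Definition upper_half_plane {R : realType} : set (R * R) :=
  [set p : R * R | 0 < p.1].

(* C^1 functions of (t, x) with compact support in ]0, +oo[ x R. *)
Definition test_function {R : realType} (phi : R -> R -> R) : Prop :=
  let supp := closure [set p : R * R | phi p.1 p.2 != 0] in
  [/\ forall t x : R, derivable (fun s => phi s x) t 1 /\ derivable (phi t) x 1,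
      continuous (fun p : R * R => dt phi p.1 p.2),
      continuous (fun p : R * R => dx phi p.1 p.2),
      compact supp
    & supp `<=` upper_half_plane].

(* u t is a representative of u(t, .); continuity in time with values in L^1
   makes u(t, .) well defined a.e. for every single t. *)
Record entropy_solution {R : realType} (f u0 : R -> R) (u : R -> R -> R)
    : Prop := EntropySolution {
  entropy_solution_L1 : forall t : R, 0 <= t -> L1 (u t) ;
  entropy_solution_bounded :
    exists C : R, forall t : R, 0 <= t -> (norm_Linfty (u t) <= C%:E)%E ;
  entropy_solution_measurable :
    measurable_fun upper_half_plane (fun p : R * R => u p.1 p.2) ;
  entropy_solution_continuous : forall t0 : R, 0 <= t0 ->
    d_L1 (u t) (u t0) @[t --> within [set t : R | 0 <= t] (nbhs t0)] --> 0%E ;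
  entropy_solution_initial : {ae @lebesgue_measure R, forall x, u 0 x = u0 x} ;
  entropy_solution_weak : forall phi, test_function phi ->
    \int[(@lebesgue_measure R \x @lebesgue_measure R)%E]_(p in upper_half_plane)
      (u p.1 p.2 * dt phi p.1 p.2 + f (u p.1 p.2) * dx phi p.1 p.2) = 0 ;
  entropy_solution_Kruzhkov : forall (k : R) phi, test_function phi ->
    (forall t x : R, 0 <= phi t x) ->
    0 <= \int[(@lebesgue_measure R \x @lebesgue_measure R)%E]_(p in
      upper_half_plane)
      (`|u p.1 p.2 - k| * dt phi p.1 p.2
       + Num.sg (u p.1 p.2 - k) * (f (u p.1 p.2) - f k) * dx phi p.1 p.2)
}.

(* By Kruzhkov's theorem such an S exists, S t u0 is determined a.e. by the
   class of u0, and the semigroup law and the L^1-contraction follow. *)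
Definition entropy_semigroup {R : realType} (f : R -> R)
    (S : R -> (R -> R) -> R -> R) : Prop :=
  forall u0, L1 u0 -> Linfty u0 -> entropy_solution f u0 (fun t => S t u0).

Definition affine_dist {R : realType} (f : R -> R) (a b : R) : \bar R :=
  ereal_inf [set norm_Linfty ((fun v => f v - (g.1 * v + g.2)) \_ `[a, b])
            | g in [set: R * R]].

Definition dfrak {R : realType} (f : R -> R) (M h : R) : \bar R :=
  ereal_inf [set affine_dist f a (a + h) | a in `[- M, M - h]].

Definition convex_minorants {R : realType} (f : R -> R) (M : R)
    : set (R -> R) :=
  [set phi | [/\ convex_function (`[0, +oo[%classic : set R^o) phi,
                 forall x : R, 0 <= x -> 0 <= phi x,
                 phi 0 = 0
               & forall h : R, 0 <= h <= 2 * M ->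
                   ((phi h)%:E <= dfrak f M h)%E]].

(* Equal to +oo at x > 2 * M. *)
Definition Phi {R : realType} (f : R -> R) (M x : R) : \bar R :=
  ereal_sup [set (phi x)%:E | phi in convex_minorants f M].

Definition Psi {R : realType} (f : R -> R) (M x : R) : \bar R :=
  (Phi f M (x / 2) * x%:E)%E.

Definition TV_gen {R : realType} (psi : R -> \bar R) (g : R -> R) : \bar R :=
  ereal_sup [set s : \bar R | exists (n : nat) (x : nat -> R),
    (forall i, (i < n)%N -> x i < x i.+1) /\
    s = (\sum_(0 <= i < n) psi `|g (x i.+1) - g (x i)|%R)%E].

Definition regularity_constant {R : realType} (f : R -> R)
    (S : R -> (R -> R) -> R -> R) (L M gamma : R) : Prop :=
  0 < gamma /\
  forall (T : R) (u0 : R -> R), 0 < T -> initial_data L M u0 ->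
    exists2 g : R -> R, {ae @lebesgue_measure R, forall x, g x = S T u0 x} &
      (TV_gen (Psi f M) g <= (gamma * (1 + T^-1))%:E)%E.

(* Main.v *)
Require Import Defs.
From mathcomp Require Import measurable_realfun ess_sup_inf zify ring lra.

Set Implicit Arguments.
Unset Strict Implicit.
Unset Printing Implicit Defensive.

Local Open Scope ring_scope.
Local Open Scope classical_set_scope.

(** Support of the solutions. Comparing an entropy solution u with a
    constant k, through the entropy |u - k| + s (u - k) with |s| <= 1, needs
    no doubling of variables. On the test function chi(t) w(t, x), where w
    is positive exactly in the cone a + lam t < x < b - lam t, the inward
    motion of the cone at speed lam absorbs the flux as soon as lam bounds
    the Lipschitz constant of f, so the integral of the entropy against w
    does not increase in time. If the entropy of the datum vanishes on [a,
    b], that of u(T) vanishes on the cone. The choices k = M, s = 1 and k =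
    -M, s = -1 give the maximum principle; then k = 0, s = 0 and the sharp
    speed lam = f'_M show that u(T) is supported in [-D, D] with D = L + T
    f'_M.

    Counting. Put h = eps / (4 D) and W = gamma (1 + 1/T) / Psi(h).
    Convexity of Phi gives Psi(y) >= (y/h)^2 Psi(h) for y >= h, so along any
    increasing sequence the jumps o h of size at least h satisfy sum o^2 <=
    W. Cut [-D, D] into floor(W) + 1 cells and round the value at the left
    end of each cell to a multiple of h: the L1 error is at most 2 D h (13/8
    + 1/4) < 4 D h = eps, and the rounded values form an integer path
    starting at 0 with total variation at most 2 floor(W). Such a path is a
    word of length 3 floor(W) on three letters, hence at most 27^W balls
    suffice. *)

(** * C1 cutoff functions *)

Section pointwise_continuity.
Context {R : realType} {T : topologicalType}.
Implicit Types f g : T -> R.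

Lemma continuous_fun_cst (c : R) : continuous (fun _ : T => c).
Proof. exact: cst_continuous. Qed.

Lemma continuous_funD f g : continuous f -> continuous g ->
  continuous (fun x => f x + g x).
Proof. by move=> cf cg x; exact: (@continuousD _ _ _ f g x (cf x) (cg x)). Qed.

Lemma continuous_funB f g : continuous f -> continuous g ->
  continuous (fun x => f x - g x).
Proof. by move=> cf cg x; exact: (@continuousB _ _ _ f g x (cf x) (cg x)). Qed.

Lemma continuous_funM f g : continuous f -> continuous g ->
  continuous (fun x => f x * g x).
Proof. by move=> cf cg x; exact: (@continuousM _ _ f g x (cf x) (cg x)). Qed.

Lemma continuous_fun_comp (h : R -> R) f : continuous h -> continuous f ->
  continuous (fun x => h (f x)).
Proof. by move=> ch cf x; apply: continuous_comp; [exact: cf|exact: ch]. Qed.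

End pointwise_continuity.

Definition pospart {R : realType} (y : R) : R := Num.max y 0.
(** C1 but not C2 at 0. Test functions need only be C1, so every cutoff below is assembled from
    translates of this one function. *)
Definition sqpos {R : realType} (y : R) : R := pospart y ^+ 2.

Section pospart.
Context {R : realType}.
Implicit Types y h : R.

Lemma pospart_ge0 y : 0 <= pospart y.
Proof. by rewrite /pospart le_max lexx orbT. Qed.

Lemma pospart_eq0 y : y <= 0 -> pospart y = 0.
Proof. by move=> y0; rewrite /pospart max_r. Qed.

Lemma pospart_id y : 0 <= y -> pospart y = y.
Proof. by move=> y0; rewrite /pospart max_l. Qed.

Lemma sqpos_ge0 y : 0 <= sqpos y.
Proof. exact: sqr_ge0. Qed.

Lemma continuous_pospart : continuous (@pospart R).
Proof.
move=> y; apply: (@continuous_max R R^o id (cst 0)); first exact: cvg_id.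
exact: cst_continuous.
Qed.

(** The quadratic remainder survives the kink at 0: when [y] and [y + h] have opposite signs, both
    are at most [|h|] in absolute value. *)
Lemma sqpos_taylor y h : `|sqpos (y + h) - sqpos y - 2 * pospart y * h| <= h ^+ 2.
Proof.
rewrite /sqpos ler_norml.
have [y0|y0] := leP 0 y; have [z0|z0] := leP 0 (y + h).
- by rewrite !pospart_id//; apply/andP; split; nra.
- rewrite (pospart_id y0) (pospart_eq0 (ltW z0)); apply/andP; split; nra.
- rewrite (pospart_id z0) (pospart_eq0 (ltW y0)); apply/andP; split; nra.
- rewrite (pospart_eq0 (ltW z0)) (pospart_eq0 (ltW y0)); apply/andP; split; nra.
Qed.

Global Instance is_derive_sqpos y : is_derive y 1 (@sqpos R) (2 * pospart y).
Proof.
have H : h^-1 *: ((@sqpos R \o shift y) (h *: 1) - sqpos y) @[h --> 0^'] -->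
    2 * pospart y.
  apply/cvgrPdist_le => e e0; near=> h.
  have h0 : h != 0 by near: h; exact: nbhs_dnbhs_neq.
  rewrite /= /shift /= [h *: 1]mulr1 (addrC h).
  rewrite [_ *: _](_ : _ = h^-1 * (sqpos (y + h) - sqpos y))//.
  have -> : 2 * pospart y - h^-1 * (sqpos (y + h) - sqpos y) =
    - (h^-1 * (sqpos (y + h) - sqpos y - 2 * pospart y * h)) by field.
  rewrite normrN normrM normfV ler_pdivrMl ?normr_gt0//.
  rewrite (le_trans (sqpos_taylor _ _))// -(real_normK (num_real h)) expr2.
  rewrite ler_wpM2l//; near: h.
  apply: nbhs_dnbhs; exact: (@nbhs0_le R R^o).
split; first by apply/cvg_ex; eexists; exact: H.
by apply/cvg_lim => //; exact: H.
Unshelve. all: by end_near. Qed.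

Lemma measurable_pospart : measurable_fun setT (@pospart R).
Proof. exact: continuous_measurable_fun continuous_pospart. Qed.

End pospart.

Lemma is_derive_affine_comp (R : realType) (F : R -> R) (dF c d t : R) :
  is_derive (c * t + d) 1 F dF -> is_derive t 1 (fun r => F (c * r + d)) (c * dF).
Proof.
move=> HF.
have H1 : is_derive t (1 : R) (fun r : R => c * r + d) c.
  have -> : (fun r : R => c * r + d) = (c \*: id) + cst d by apply/funext.
  by apply: is_derive_eq; rewrite addr0 [_ *: _]mulr1.
have := @is_derive1_comp R F (fun r : R => c * r + d) t dF c HF H1.
by move=> H; apply: is_derive_eq; rewrite mulrC.
Qed.

(** * Smooth ramps and time windows *)

Section ramp.
Context {R : realType}.
Implicit Types y t s T delta : R.

(** A C1 transition from 0 to 1 over [0, 1], made of two parabolic arcs glued at 1/2. Its derivative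
    [tent] is the hat function of height 2 on [0, 1]. *)
Definition ramp y : R := 2 * (sqpos y - 2 * sqpos (y - 2^-1) + sqpos (y - 1)).
Definition tent y : R :=
  4 * (pospart y - 2 * pospart (y - 2^-1) + pospart (y - 1)).

Lemma ramp_eq0 y : y <= 0 -> ramp y = 0.
Proof. by move=> y0; rewrite /ramp /sqpos !pospart_eq0; lra. Qed.

Lemma ramp_eq1 y : 1 <= y -> ramp y = 1.
Proof. by move=> y0; rewrite /ramp /sqpos !pospart_id; lra. Qed.

Lemma ramp_itv y : 0 <= ramp y <= 1.
Proof.
have [y0|y0] := leP y 0; first by rewrite ramp_eq0// lexx ler01.
have [y1|y1] := leP 1 y; first by rewrite ramp_eq1// lexx ler01.
rewrite /ramp /sqpos (pospart_id (ltW y0)) (@pospart_eq0 _ (y - 1)); last by lra.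
have [y2|y2] := leP y 2^-1.
  by rewrite pospart_eq0; [apply/andP; split; nra|lra].
by rewrite pospart_id; [apply/andP; split; nra|lra].
Qed.

Lemma tent_eq0 y : ~~ (0 < y < 1) -> tent y = 0.
Proof.
rewrite negb_and -!leNgt => /orP[y0|y0]; rewrite /tent.
  by rewrite !pospart_eq0; lra.
by rewrite !pospart_id; lra.
Qed.

Lemma tent_itv y : 0 <= tent y <= 2.
Proof.
have [/andP[y0 y1]|y01] := boolP (0 < y < 1); last first.
  by rewrite tent_eq0// lexx ler0n.
rewrite /tent (pospart_id (ltW y0)) (@pospart_eq0 _ (y - 1)); last by lra.
have [y2|y2] := leP y 2^-1; [rewrite pospart_eq0|rewrite pospart_id]; lra.
Qed.

(** On the middle half of its support the hat is at least half its height; this gives the lower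
    bound on the time weight just after T. *)
Lemma tent_ge1 y : 4^-1 <= y <= 3 / 4 -> 1 <= tent y.
Proof.
move=> /andP[y0 y1].
rewrite /tent (@pospart_id _ y) ?(@pospart_eq0 _ (y - 1)); try lra.
have [y2|y2] := leP y 2^-1; [rewrite pospart_eq0|rewrite pospart_id]; lra.
Qed.

Lemma is_derive_ramp y : is_derive y 1 ramp (tent y).
Proof.
have H (d : R) : is_derive y 1 (fun r : R => sqpos (r + d)) (2 * pospart (y + d)).
  have -> : (fun r => sqpos (r + d)) = (fun r => sqpos (1 * r + d)).
    by apply/funext => r; rewrite mul1r.
  rewrite -[2 * _]mul1r; apply: is_derive_affine_comp; rewrite mul1r.
  exact: is_derive_sqpos.
have H1 := H (- 2^-1); have H2 := H (- 1).
have -> : ramp = 2 \*: (sqpos - 2 \*: (fun r => sqpos (r - 2^-1)) +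
   (fun r => sqpos (r - 1))) by apply/funext.
apply: is_derive_eq; rewrite /tent !/(_ *: _) /=; ring.
Qed.

Lemma continuous_tent : continuous tent.
Proof.
have H (d : R) : continuous (fun y : R => pospart (y - d)).
  apply: continuous_fun_comp; first exact: continuous_pospart.
  by apply: continuous_funB; [move=> ?; exact: cvg_id|exact: continuous_fun_cst].
apply: continuous_funM; first exact: continuous_fun_cst.
apply: continuous_funD; last exact: H.
apply: continuous_funB; first exact: continuous_pospart.
by apply: continuous_funM; [exact: continuous_fun_cst|exact: H].
Qed.

(** Rises over [s, 2s] and falls over [T, T + delta]. Its derivative is a positive hat near time 0
    minus a hat just after T, so testing with it compares averages at these two times. *)
Definition window s T delta t : R := ramp ((t - s) / s) - ramp ((t - T) / delta).
Definition window' s T delta t : R :=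
  s^-1 * tent ((t - s) / s) - delta^-1 * tent ((t - T) / delta).

Lemma is_derive_window s T delta t :
  is_derive t 1 (window s T delta) (window' s T delta t).
Proof.
have H (s0 d : R) : is_derive t (1 : R) (fun r : R => ramp ((r - s0) / d))
    (d^-1 * tent ((t - s0) / d)).
  have -> : (fun r => ramp ((r - s0) / d)) = (fun r => ramp (d^-1 * r + - s0 / d)).
    by apply/funext => r; congr ramp; ring.
  apply: is_derive_affine_comp.
  have -> : d^-1 * t + - s0 / d = (t - s0) / d by ring.
  exact: is_derive_ramp.
exact: is_deriveB.
Qed.

Lemma continuous_window' s T delta : continuous (window' s T delta).
Proof.
have H (s0 d : R) : continuous (fun r : R => d^-1 * tent ((r - s0) / d)).
  apply: continuous_funM; first exact: continuous_fun_cst.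
  apply: continuous_fun_comp; first exact: continuous_tent.
  apply: continuous_funM; last exact: continuous_fun_cst.
  by apply: continuous_funB; [move=> ?; exact: cvg_id|exact: continuous_fun_cst].
by apply: continuous_funB; exact: H.
Qed.

Lemma window_ge0 s T delta t : 0 < s -> 2 * s <= T -> 0 < delta ->
  0 <= window s T delta t.
Proof.
move=> s0 sT d0; rewrite /window subr_ge0.
have [tT|tT] := leP t T.
  rewrite ramp_eq0; first by have /andP[] := ramp_itv ((t - s) / s).
  by rewrite pmulr_lle0 ?invr_gt0// subr_le0.
rewrite (@ramp_eq1 ((t - s) / s)); first by have /andP[] := ramp_itv ((t - T) / delta).
by rewrite ler_pdivlMr// mul1r; lra.
Qed.

Lemma window_eq0 s T delta t : 0 < s -> 2 * s <= T -> 0 < delta ->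
  ~~ (s < t < T + delta) -> window s T delta t = 0.
Proof.
move=> s0 sT d0; rewrite negb_and -!leNgt => /orP[ts|ts]; rewrite /window.
  by rewrite !ramp_eq0 ?subrr// pmulr_lle0 ?invr_gt0//; lra.
by rewrite !ramp_eq1 ?subrr// ler_pdivlMr//; lra.
Qed.

End ramp.

(** * The test functions: a time window times a shrinking cone *)

Section cone.
Context {R : realType}.
Variables lam a b : R.
Implicit Types t x : R.

Definition cone t x : R := sqpos (x - lam * t - a) * sqpos (b - x - lam * t).

(** The contributions of the left and right edges to the product rule. Both are nonnegative; the
    time derivative of [cone] is [- lam] times their sum and the space derivative is their
    difference, so a flux bounded by [lam] times the entropy is dominated. *)
Definition cone_left t x : R :=
  2 * pospart (x - lam * t - a) * sqpos (b - x - lam * t).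
Definition cone_right t x : R :=
  2 * pospart (b - x - lam * t) * sqpos (x - lam * t - a).

Lemma cone_ge0 t x : 0 <= cone t x.
Proof. by rewrite mulr_ge0// sqpos_ge0. Qed.

Lemma cone_left_ge0 t x : 0 <= cone_left t x.
Proof. by rewrite !mulr_ge0// ?pospart_ge0// sqpos_ge0. Qed.

Lemma cone_right_ge0 t x : 0 <= cone_right t x.
Proof. by rewrite !mulr_ge0// ?pospart_ge0// sqpos_ge0. Qed.

Lemma is_derive_cone_t t x :
  is_derive t 1 (cone^~ x) (- lam * (cone_left t x + cone_right t x)).
Proof.
have H1 : is_derive t 1 (fun r : R => sqpos (x - lam * r - a))
    (- lam * (2 * pospart (x - lam * t - a))).
  have -> : (fun r => sqpos (x - lam * r - a)) = (fun r => sqpos (- lam * r + (x - a))).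
    by apply/funext => r; congr sqpos; ring.
  have -> : x - lam * t - a = - lam * t + (x - a) by ring.
  exact: is_derive_affine_comp.
have H2 : is_derive t 1 (fun r : R => sqpos (b - x - lam * r))
    (- lam * (2 * pospart (b - x - lam * t))).
  have -> : (fun r => sqpos (b - x - lam * r)) = (fun r => sqpos (- lam * r + (b - x))).
    by apply/funext => r; congr sqpos; ring.
  have -> : b - x - lam * t = - lam * t + (b - x) by ring.
  exact: is_derive_affine_comp.
have := is_deriveM H1 H2; move=> H.
apply: is_derive_eq; rewrite /cone_left /cone_right !/(_ *: _) /=; ring.
Qed.

Lemma is_derive_cone_x t x :
  is_derive x 1 (cone t) (cone_left t x - cone_right t x).
Proof.
have H1 : is_derive x 1 (fun r : R => sqpos (r - lam * t - a))
    (1 * (2 * pospart (x - lam * t - a))).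
  have -> : (fun r => sqpos (r - lam * t - a)) = (fun r => sqpos (1 * r + (- (lam * t) - a))).
    by apply/funext => r; congr sqpos; ring.
  have -> : x - lam * t - a = 1 * x + (- (lam * t) - a) by ring.
  exact: is_derive_affine_comp.
have H2 : is_derive x 1 (fun r : R => sqpos (b - r - lam * t))
    (-1 * (2 * pospart (b - x - lam * t))).
  have -> : (fun r => sqpos (b - r - lam * t)) = (fun r => sqpos (-1 * r + (b - lam * t))).
    by apply/funext => r; congr sqpos; ring.
  have -> : b - x - lam * t = -1 * x + (b - lam * t) by ring.
  exact: is_derive_affine_comp.
have := is_deriveM H1 H2; move=> H.
apply: is_derive_eq; rewrite /cone_left /cone_right !/(_ *: _) /=; ring.
Qed.

Let cvP : continuous (fun p : R * R => pospart (p.2 - lam * p.1 - a)).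
Proof.
apply: continuous_fun_comp; first exact: continuous_pospart.
apply: continuous_funB; last exact: continuous_fun_cst.
apply: continuous_funB; first by move=> ?; exact: cvg_snd.
by apply: continuous_funM; [exact: continuous_fun_cst|by move=> ?; exact: cvg_fst].
Qed.

Let cvQ : continuous (fun p : R * R => pospart (b - p.2 - lam * p.1)).
Proof.
apply: continuous_fun_comp; first exact: continuous_pospart.
apply: continuous_funB.
  by apply: continuous_funB; [exact: continuous_fun_cst|by move=> ?; exact: cvg_snd].
by apply: continuous_funM; [exact: continuous_fun_cst|by move=> ?; exact: cvg_fst].
Qed.

Lemma continuous_cone : continuous (fun p : R * R => cone p.1 p.2).
Proof.
rewrite /cone /sqpos.
by apply: continuous_funM; apply: continuous_funM; (exact: cvP || exact: cvQ).
Qed.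

Lemma continuous_cone_left : continuous (fun p : R * R => cone_left p.1 p.2).
Proof.
rewrite /cone_left /sqpos; apply: continuous_funM; last by apply: continuous_funM; exact: cvQ.
by apply: continuous_funM; [exact: continuous_fun_cst|exact: cvP].
Qed.

Lemma continuous_cone_right : continuous (fun p : R * R => cone_right p.1 p.2).
Proof.
rewrite /cone_right /sqpos; apply: continuous_funM; last by apply: continuous_funM; exact: cvP.
by apply: continuous_funM; [exact: continuous_fun_cst|exact: cvQ].
Qed.

Hypothesis lam_ge0 : 0 <= lam.

Lemma cone_outside t x : 0 <= t -> ~~ (a <= x <= b) ->
  [/\ cone t x = 0, cone_left t x = 0 & cone_right t x = 0].
Proof.
move=> t0; have lt0 : 0 <= lam * t by rewrite mulr_ge0.
rewrite negb_and -!ltNge /cone /cone_left /cone_right /sqpos => /orP[xa|bx].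
  by rewrite (@pospart_eq0 _ (x - lam * t - a)); [split; ring|lra].
by rewrite (@pospart_eq0 _ (b - x - lam * t)); [split; ring|lra].
Qed.

Lemma cone_le t x : 0 <= t -> cone t x <= (b - a) ^+ 4.
Proof.
move=> t0; have lt0 : 0 <= lam * t by rewrite mulr_ge0.
have [/andP[ax xb]|/(cone_outside t0)[-> _ _]] := boolP (a <= x <= b); last first.
  by rewrite (_ : _ ^+ 4 = ((b - a) ^+ 2) ^+ 2) ?sqr_ge0// -exprM.
have H y : y <= b - a -> sqpos y <= (b - a) ^+ 2.
  move=> yba; rewrite /sqpos lerXn2r ?nnegrE ?pospart_ge0//; first by lra.
  by rewrite /pospart ge_max yba; lra.
rewrite (_ : _ ^+ 4 = (b - a) ^+ 2 * (b - a) ^+ 2); last by rewrite -exprD.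
by rewrite ler_pM// ?sqpos_ge0// H//; lra.
Qed.

Lemma cone_ge t x (d : R) : 0 <= d -> a + lam * t + d <= x -> x <= b - lam * t - d ->
  d ^+ 4 <= cone t x.
Proof.
move=> d0 ax xb.
rewrite (_ : _ ^+ 4 = d ^+ 2 * d ^+ 2); last by rewrite -exprD.
by rewrite ler_pM// ?sqr_ge0// /sqpos lerXn2r ?nnegrE ?pospart_ge0//
  /pospart le_max; apply/orP; left; lra.
Qed.

Variables (chi chi' : R -> R) (t0 t1 : R).
Hypothesis t0_gt0 : 0 < t0.
Hypothesis chi_derive : forall t, is_derive t 1 chi (chi' t).
Hypothesis chi_cont : continuous chi'.
Hypothesis chi_out : forall t, ~~ (t0 < t < t1) -> chi t = 0.

Definition cone_test t x : R := chi t * cone t x.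
Definition cone_test_t t x : R :=
  chi' t * cone t x - lam * (chi t * (cone_left t x + cone_right t x)).
Definition cone_test_x t x : R := chi t * (cone_left t x - cone_right t x).

Lemma is_derive_cone_test_t t x :
  is_derive t 1 (cone_test^~ x) (cone_test_t t x).
Proof.
have := is_deriveM (chi_derive t) (is_derive_cone_t t x); move=> H.
apply: is_derive_eq; rewrite /cone_test_t !/(_ *: _) /=; ring.
Qed.

Lemma is_derive_cone_test_x t x :
  is_derive x 1 (cone_test t) (cone_test_x t x).
Proof.
have H := is_derive_cone_x t x.
have -> : cone_test t = chi t \*: cone t by apply/funext.
exact: is_deriveZ.
Qed.

Lemma dt_cone_test t x : dt cone_test t x = cone_test_t t x.
Proof.
by rewrite /dt derive1E; have H := is_derive_cone_test_t t x; rewrite derive_val.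
Qed.

Lemma dx_cone_test t x : dx cone_test t x = cone_test_x t x.
Proof.
by rewrite /dx derive1E; have H := is_derive_cone_test_x t x; rewrite derive_val.
Qed.

Let cchi : continuous chi.
Proof.
move=> t; apply: differentiable_continuous; apply/derivable1_diffP.
by have H := chi_derive t; exact: ex_derive.
Qed.

Let cchi1 : continuous (fun p : R * R => chi p.1).
Proof. by apply: continuous_fun_comp; [|by move=> ?; exact: cvg_fst]; exact: cchi. Qed.

Let cchi1' : continuous (fun p : R * R => chi' p.1).
Proof. by apply: continuous_fun_comp; [|by move=> ?; exact: cvg_fst]; exact: chi_cont. Qed.

Lemma continuous_cone_test_t : continuous (fun p : R * R => cone_test_t p.1 p.2).
Proof.
rewrite /cone_test_t; apply: continuous_funB.
  by apply: continuous_funM; [exact: cchi1'|exact: continuous_cone].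
apply: continuous_funM; first exact: continuous_fun_cst.
apply: continuous_funM; first exact: cchi1.
by apply: continuous_funD; [exact: continuous_cone_left|exact: continuous_cone_right].
Qed.

Lemma continuous_cone_test_x : continuous (fun p : R * R => cone_test_x p.1 p.2).
Proof.
rewrite /cone_test_x; apply: continuous_funM; first exact: cchi1.
by apply: continuous_funB; [exact: continuous_cone_left|exact: continuous_cone_right].
Qed.

(** The support lies in [t0, t1] x [a, b]: [chi] vanishes at other times, and at nonnegative times
    the cone stays inside [a, b]. Since t0 > 0, this rectangle is a compact subset of the open
    half-plane. *)
Lemma test_function_cone_test : test_function cone_test.
Proof.
have sub : closure [set p : R * R | cone_test p.1 p.2 != 0] `<=`
    `[t0, t1] `*` `[a, b].
  have cl : closed (`[t0, t1] `*` `[a, b] : set (R * R)).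
    apply: compact_closed; first exact: norm_hausdorff.
    by apply: compact_setX; exact: segment_compact.
  move/closure_id : cl => ->; apply: closure_subset => -[t x] /= tx0.
  have tt : t0 < t < t1 by apply: contraNT tx0 => /chi_out; rewrite /cone_test => ->; rewrite mul0r.
  have xab : a <= x <= b.
    have t_ge0 : 0 <= t by case/andP : tt => /(lt_trans t0_gt0)/ltW.
    apply: contraNT tx0 => /(cone_outside t_ge0)[].
    by move=> e _ _; rewrite /cone_test e mulr0.
  split => /=; rewrite in_itv/= ?xab//.
  by case/andP : tt => ? ?; rewrite !ltW.
split.
- move=> t x; split.
    by have H := is_derive_cone_test_t t x; exact: ex_derive.
  by have H := is_derive_cone_test_x t x; exact: ex_derive.
- under eq_fun do rewrite dt_cone_test; exact: continuous_cone_test_t.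
- under eq_fun do rewrite dx_cone_test; exact: continuous_cone_test_x.
- apply: (subclosed_compact _ _ sub); first exact: closed_closure.
  by apply: compact_setX; exact: segment_compact.
- move=> p /sub [/= + _]; rewrite in_itv/= /upper_half_plane/= => /andP[+ _].
  exact: lt_le_trans.
Qed.

End cone.

(** * Lebesgue measure on the half-plane and truncation of the solution *)

Section almost_everywhere_logic.
Context d (T : measurableType d) (R : realType).
Variable m : {measure set T -> \bar R}.
Implicit Types P Q Z : T -> Prop.

Lemma ae_imp P Q : (forall x, P x -> Q x) ->
  {ae m, forall x, P x} -> {ae m, forall x, Q x}.
Proof.
move=> PQ; exact: (@filterS _ _ (ae_filter_ringOfSetsType m) _ _ PQ).
Qed.

Lemma ae_imp2 P Q Z : (forall x, P x -> Q x -> Z x) ->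
  {ae m, forall x, P x} -> {ae m, forall x, Q x} -> {ae m, forall x, Z x}.
Proof.
move=> PQ; exact: (@filterS2 _ _ (ae_filter_ringOfSetsType m) _ _ _ PQ).
Qed.

Lemma ae_forall (P : nat -> T -> Prop) : (forall n, {ae m, forall x, P n x}) ->
  {ae m, forall x n, P n x}.
Proof.
move=> h; have := negligible_bigcup h.
by apply: negligibleS => x /= /existsNP[n Pn]; exists n.
Qed.

End almost_everywhere_logic.

Section lebesgue_plane.
Context {R : realType}.
Local Notation TR := (measurableTypeR R).
Local Notation mu := (@lebesgue_measure R).
Local Notation mu2 := (mu \x mu)%E.

Lemma lebesgue_measureT_gt0 : (0 < mu [set: R])%E.
Proof.
have : (mu `[0%R, 1%R]%classic <= mu [set: R])%E by rewrite le_measure ?inE.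
by apply: lt_le_trans; rewrite lebesgue_measure_itv/= lte01 oppr0 adde0 lte01.
Qed.

Lemma norm_Linfty_leP (g : R -> R) (C : R) :
  (norm_Linfty g <= C%:E)%E <-> {ae mu, forall x, `|g x| <= C}.
Proof.
(* The norm of exponent +oo is an essential supremum only on a space of positive measure. *)
rewrite /norm_Linfty unlock lebesgue_measureT_gt0.
split => [/ess_supP|h]; last apply/ess_supP.
  by apply: ae_imp => x /=; rewrite lee_fin.
by apply: ae_imp h => x /=; rewrite lee_fin.
Qed.

Lemma upper_half_planeE :
  upper_half_plane = `]0, +oo[%classic `*` [set: R] :> set (R * R).
Proof.
apply/seteqP; split => [[t x]|[t x] [/=]]; rewrite /upper_half_plane/=.
  by move=> t0; split => //=; rewrite in_itv/= t0.
by rewrite in_itv/= andbT.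
Qed.

Lemma measurable_upper_half_plane :
  measurable (upper_half_plane : set (TR * TR)).
Proof. by rewrite upper_half_planeE; exact: measurableX. Qed.

Definition rectangle (t0 t1 a b : R) : set (TR * TR) := `[t0, t1] `*` `[a, b].

Lemma measurable_rectangle t0 t1 a b : measurable (rectangle t0 t1 a b).
Proof. exact: measurableX. Qed.

Lemma rectangle_fin t0 t1 a b : (mu2 (rectangle t0 t1 a b) < +oo)%E.
Proof.
rewrite product_measure1E//= !lebesgue_measure_itv/=.
by rewrite -!EFinB; do 2 case: ifP => _; rewrite ?mule0 ?mul0e ?ltry// -EFinM ltry.
Qed.

Lemma continuous_rectangle_bounded (X : TR * TR -> R) t0 t1 a b :
  continuous X -> (forall p, ~ rectangle t0 t1 a b p -> X p = 0) ->
  exists2 K : R, 0 <= K & forall p, `|X p| <= K.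
Proof.
move=> cX X0.
have : compact (X @` rectangle t0 t1 a b).
  apply: continuous_compact; first exact: continuous_subspaceT.
  by apply: compact_setX; exact: segment_compact.
move/(@compact_bounded R R^o) => [K [_ KX]].
exists (`|K| + 1) => [|p]; first by rewrite addr_ge0.
have [pQ|/X0 ->] := pselect (rectangle t0 t1 a b p); last by rewrite normr0 addr_ge0.
apply: (KX (`|K| + 1)); last by exists p.
by rewrite (le_lt_trans (ler_norm _))// ltrDl.
Qed.

(** Integrability of all the entropy integrands reduces to this: bounded, measurable, and zero off a
    rectangle of finite measure. *)
Lemma integrable_rectangle (X : TR * TR -> R) (K t0 t1 a b : R) :
  measurable_fun setT X -> (forall p, `|X p| <= K) ->
  (forall p, ~ rectangle t0 t1 a b p -> X p = 0) ->
  mu2.-integrable setT (EFin \o X).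
Proof.
move=> mX XK X0.
have : mu2.-integrable (rectangle t0 t1 a b) (EFin \o X).
  apply: measurable_bounded_integrable.
  - exact: measurable_rectangle.
  - exact: rectangle_fin.
  - exact: measurable_funTS.
  - exists K; split; first exact: num_real.
    by move=> r Kr p _; apply: (le_trans (XK p)); exact: ltW.
move=> iX; have := (integrable_mkcond _ (measurable_rectangle t0 t1 a b)).1 iX.
apply: eq_integrable => // p _; rewrite patchE; case: ifPn => //.
by rewrite notin_setE => /X0 /= ->.
Qed.

End lebesgue_plane.

Section truncation.
Context {R : realType}.
Local Notation TR := (measurableTypeR R).
Local Notation mu := (@lebesgue_measure R).
Local Notation mu2 := (mu \x mu)%E.
Local Notation H := (@upper_half_plane R : set (TR * TR)).

Definition clamp (C y : R) : R := Num.max (- C) (Num.min y C).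

Lemma clamp_id C y : `|y| <= C -> clamp C y = y.
Proof. by rewrite ler_norml /clamp => /andP[? ?]; rewrite min_l// max_r. Qed.

Lemma clamp_le C y : 0 <= C -> `|clamp C y| <= C.
Proof.
move=> C0; rewrite /clamp ler_norml le_max lexx/= ge_max ge_min lexx orbT andbT.
by lra.
Qed.

Variables (u : R -> R -> R) (C : R).
Hypothesis C_ge0 : 0 <= C.
Hypothesis mu_u : measurable_fun H (fun p : TR * TR => u p.1 p.2).
Hypothesis u_le : forall t, 0 <= t -> {ae mu, forall x, `|u t x| <= C}.

(* Agrees with u almost everywhere on the half-plane, but is bounded and measurable
   everywhere, so that all the integrands below are integrable. *)
Definition trunc : TR * TR -> R := (fun p : R * R => clamp C (u p.1 p.2)) \_ H.

Lemma trunc_le p : `|trunc p| <= C.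
Proof.
by rewrite /trunc patchE; case: ifPn => _; rewrite ?normr0//; exact: clamp_le.
Qed.

Lemma measurable_trunc : measurable_fun setT trunc.
Proof.
apply: (measurable_restrictT _ measurable_upper_half_plane).1.
have mc : measurable_fun H (cst C : TR * TR -> R) by exact: measurable_cst.
have mc' : measurable_fun H (cst (- C) : TR * TR -> R) by exact: measurable_cst.
exact: (measurable_maxr mc' (measurable_minr mu_u mc)).
Qed.

Lemma trunc_section t : 0 < t -> {ae mu, forall x, trunc (t, x) = u t x}.
Proof.
move=> t0; apply: ae_imp (u_le (ltW t0)) => x ux.
by rewrite /trunc patchE mem_set//= clamp_id.
Qed.

(** The null set where the bound on [u t] fails depends on t. The set of all points with [|u| > C]
    is measurable and its time sections are null, hence it is null for the product measure. *)
Lemma trunc_ae : {ae mu2, forall p, H p -> u p.1 p.2 = trunc p}.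
Proof.
pose N := H `&` [set p : TR * TR | C < `|u p.1 p.2| ].
have mN : measurable N.
  have mabs : measurable_fun H (fun p : TR * TR => `|u p.1 p.2|).
    exact: measurableT_comp.
  have := mabs measurable_upper_half_plane `]C, +oo[%classic.
  move=> /(_ (measurable_itv _)); congr measurable.
  by apply/seteqP; split => p [Hp /=]; rewrite in_itv/= ?andbT => ?; split => //=; rewrite in_itv/= andbT.
exists N; split => //.
  rewrite /product_measure1 (eq_integral (cst 0%E)) ?integral0// => t _ /=.
  have mNt : measurable (xsection N t) by exact: measurable_xsection.
  apply/(negligibleP _ mNt).
  have [t0|t0] := ltP 0 t.
    have [B [mB B0 sB]] := u_le (ltW t0).
    exists B; split => // x; rewrite xsectionE => -[_ /= Cu]; apply: sB => /=.
    by rewrite leNgt Cu.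
  rewrite (_ : xsection N t = set0); first exact: negligible_set0.
  apply/seteqP; split => // x; rewrite xsectionE => -[]; rewrite /upper_half_plane/=.
  by rewrite ltNge t0.
move=> p /= /not_implyP[Hp up]; split => //=.
rewrite ltNge; apply/negP => /clamp_id e; apply: up.
by rewrite /trunc patchE mem_set//= e.
Qed.

(** Transfers the weak and entropy formulations from [u] on the half-plane to [trunc] on the whole
    plane. [F] and [G] are merely measurable because Kruzhkov's flux contains a sign. *)
Lemma Rintegral_trunc (F G : R -> R) (A B : TR * TR -> R) :
  measurable_fun setT F -> measurable_fun setT G ->
  measurable_fun setT A -> measurable_fun setT B ->
  (forall p, ~ H p -> A p = 0) -> (forall p, ~ H p -> B p = 0) ->
  \int[mu2]_(p in H) (F (u p.1 p.2) * A p + G (u p.1 p.2) * B p) =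
  \int[mu2]_p (F (trunc p) * A p + G (trunc p) * B p).
Proof.
move=> mF mG mA mB A0 B0.
have mAH := measurable_funTS mA : measurable_fun H A.
have mBH := measurable_funTS mB : measurable_fun H B.
have mt := measurable_funTS measurable_trunc : measurable_fun H trunc.
rewrite [RHS](_ : _ = \int[mu2]_(p in H) (F (trunc p) * A p + G (trunc p) * B p)).
  congr fine; apply: ae_eq_integral.
  - exact: measurable_upper_half_plane.
  - apply/measurable_EFinP; apply: measurable_funD; apply: measurable_funM => //;
      exact: measurableT_comp.
  - apply/measurable_EFinP; apply: measurable_funD; apply: measurable_funM => //;
      exact: measurableT_comp.
  - by apply: ae_imp trunc_ae => p up Hp; rewrite up.
rewrite [RHS]Rintegral_mkcond; apply: eq_Rintegral => p _.
rewrite patchE; case: ifPn => //; rewrite notin_setE => Hp.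
by rewrite A0// B0// !mulr0 addr0.
Qed.

End truncation.

(** * Entropy inequalities tested on the cone *)

Lemma integral_derive_compact_support (R : realType) (F F' : R -> R) (c d : R) :
  c < d -> (forall x : R, is_derive x 1 F (F' x)) -> continuous F' ->
  (forall x, ~~ (c < x < d) -> F x = 0) ->
  (forall x, ~~ (c < x < d) -> F' x = 0) ->
  (\int[@lebesgue_measure R]_x (F' x)%:E = 0)%E.
Proof.
move=> cd dF cF' F0 F'0.
have cF : continuous F.
  move=> x; apply: differentiable_continuous; apply/derivable1_diffP.
  by have H := dF x; exact: ex_derive.
rewrite (_ : (\int[_]_x _)%E = (\int[@lebesgue_measure R]_(x in `[c, d]) (F' x)%:E)%E).
  rewrite (@continuous_FTC2 R F' F c d cd).
  - by rewrite !F0 ?ltxx ?andbF// subee.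
  - exact: continuous_subspaceT.
  - split.
    + by move=> x _; have H := dF x; exact: ex_derive.
    + exact: cvg_at_right_filter (cF c).
    + exact: cvg_at_left_filter (cF d).
  - by move=> x _; rewrite derive1E; have H := dF x; rewrite derive_val.
rewrite [RHS]integral_mkcond; apply: eq_integral => x _; rewrite patchE.
case: ifPn => //; rewrite notin_setE/= in_itv/= => xcd; rewrite F'0//.
by apply/negP => /andP[? ?]; apply: xcd; rewrite !ltW.
Qed.

Lemma measurable_sgr (R : realType) : measurable_fun setT (@Num.sg R).
Proof.
have -> : @Num.sg R = fun x => if x == 0 then 0 else if x < 0 then -1 else 1.
  by apply/funext.
apply: measurable_fun_ifT => //; first exact: measurable_fun_eqr.
by apply: measurable_fun_ifT => //; exact: measurable_fun_ltr.
Qed.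

Section entropy_cone.
Context {R : realType}.
Local Notation TR := (measurableTypeR R).
Local Notation mu := (@lebesgue_measure R).
Local Notation mu2 := (mu \x mu)%E.
Local Notation H := (@upper_half_plane R : set (TR * TR)).

Variables (lam a b : R).
Hypothesis lam_ge0 : 0 <= lam.
Hypothesis ab : a < b.

Let measurableP : measurable_fun setT (fun p : TR * TR => pospart (p.2 - lam * p.1 - a)).
Proof.
apply: measurableT_comp; first exact: measurable_pospart.
apply: measurable_funB => //; apply: measurable_funB; first exact: measurable_snd.
by apply: measurable_funM => //; exact: measurable_fst.
Qed.

Let measurableQ : measurable_fun setT (fun p : TR * TR => pospart (b - p.2 - lam * p.1)).
Proof.
apply: measurableT_comp; first exact: measurable_pospart.
apply: measurable_funB.
  by apply: measurable_funB => //; exact: measurable_snd.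
by apply: measurable_funM => //; exact: measurable_fst.
Qed.

Lemma measurable_cone : measurable_fun setT (fun p : TR * TR => cone lam a b p.1 p.2).
Proof. by rewrite /cone /sqpos; apply: measurable_funM; apply: measurable_funX. Qed.

Lemma measurable_cone_left :
  measurable_fun setT (fun p : TR * TR => cone_left lam a b p.1 p.2).
Proof.
rewrite /cone_left /sqpos; apply: measurable_funM; last exact: measurable_funX.
exact: measurable_funM.
Qed.

Lemma measurable_cone_right :
  measurable_fun setT (fun p : TR * TR => cone_right lam a b p.1 p.2).
Proof.
rewrite /cone_right /sqpos; apply: measurable_funM; last exact: measurable_funX.
exact: measurable_funM.
Qed.

Variables (chi chi' : R -> R) (t0 t1 : R).
Hypothesis t0_gt0 : 0 < t0.
Hypothesis t01 : t0 < t1.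
Hypothesis chi_derive : forall t : R, is_derive t 1 chi (chi' t).
Hypothesis chi_cont : continuous chi'.
Hypothesis chi_out : forall t, ~~ (t0 < t < t1) -> chi t = 0.
Hypothesis chi'_out : forall t, ~~ (t0 < t < t1) -> chi' t = 0.

Let A (p : TR * TR) := cone_test_t lam a b chi chi' p.1 p.2.
Let B (p : TR * TR) := cone_test_x lam a b chi p.1 p.2.

Let cchi : continuous chi.
Proof.
move=> t; apply: differentiable_continuous; apply/derivable1_diffP.
by have HH := chi_derive t; exact: ex_derive.
Qed.

Let mchi : measurable_fun setT (fun p : TR * TR => chi p.1).
Proof.
apply: measurableT_comp; last exact: measurable_fst.
exact: continuous_measurable_fun.
Qed.

Let mchi' : measurable_fun setT (fun p : TR * TR => chi' p.1).
Proof.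
apply: measurableT_comp; last exact: measurable_fst.
exact: continuous_measurable_fun.
Qed.

Let mA : measurable_fun setT A.
Proof.
rewrite /A /cone_test_t; apply: measurable_funB.
  by apply: measurable_funM => //; exact: measurable_cone.
apply: measurable_funM => //; apply: measurable_funM => //.
by apply: measurable_funD; [exact: measurable_cone_left|exact: measurable_cone_right].
Qed.

Let mB : measurable_fun setT B.
Proof.
rewrite /B /cone_test_x; apply: measurable_funM => //.
by apply: measurable_funB; [exact: measurable_cone_left|exact: measurable_cone_right].
Qed.

Lemma cone_rectangle (p : TR * TR) : ~ rectangle t0 t1 a b p ->
  [\/ chi p.1 = 0 /\ chi' p.1 = 0 |
      [/\ cone lam a b p.1 p.2 = 0, cone_left lam a b p.1 p.2 = 0 &
          cone_right lam a b p.1 p.2 = 0]].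
Proof.
move=> pQ; have [tt|tt] := boolP (t0 < p.1 < t1); last by left; rewrite chi_out// chi'_out.
have [xx|xx] := boolP (a <= p.2 <= b).
  exfalso; apply: pQ; split => /=; rewrite in_itv/= ?xx//.
  by case/andP : tt => ? ?; rewrite !ltW.
right; apply: cone_outside => //.
by case/andP : tt => /(lt_trans t0_gt0)/ltW.
Qed.

Let A0 p : ~ rectangle t0 t1 a b p -> A p = 0.
Proof.
by move=> /cone_rectangle[[e e']|[e e' e'']]; rewrite /A /cone_test_t e e' ?e'' ; ring.
Qed.

Let B0 p : ~ rectangle t0 t1 a b p -> B p = 0.
Proof.
by move=> /cone_rectangle[[e e']|[e e' e'']]; rewrite /B /cone_test_x ?e ?e' ?e''; ring.
Qed.

Lemma rectangle_upper p : rectangle t0 t1 a b p -> H p.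
Proof.
by move=> [/=]; rewrite in_itv/= => /andP[/(lt_le_trans t0_gt0) + _] _.
Qed.

Let bndA : exists2 K : R, 0 <= K & forall p, `|A p| <= K.
Proof.
by apply: continuous_rectangle_bounded A0; exact: continuous_cone_test_t.
Qed.

Let bndB : exists2 K : R, 0 <= K & forall p, `|B p| <= K.
Proof.
by apply: continuous_rectangle_bounded B0; apply: continuous_cone_test_x; exact: chi_derive.
Qed.

Section integrable_product.
Variables (Y : TR * TR -> R) (K : R).
Hypothesis mY : measurable_fun setT Y.
Hypothesis YK : forall p, `|Y p| <= K.

Let integrable_product (X : TR * TR -> R) : measurable_fun setT X ->
  (forall p, ~ rectangle t0 t1 a b p -> X p = 0) ->
  (exists2 K : R, 0 <= K & forall p, `|X p| <= K) ->
  mu2.-integrable setT (EFin \o (fun p => Y p * X p)).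
Proof.
move=> mX X0 [K' K'0 XK'].
apply: (@integrable_rectangle _ _ (K * K') t0 t1 a b).
- exact: measurable_funM.
- by move=> p; rewrite normrM ler_pM.
- by move=> p /X0 ->; rewrite mulr0.
Qed.

Lemma integrable_cone_test_t : mu2.-integrable setT (EFin \o (fun p => Y p * A p)).
Proof. exact: integrable_product. Qed.

Lemma integrable_cone_test_x : mu2.-integrable setT (EFin \o (fun p => Y p * B p)).
Proof. exact: integrable_product. Qed.

Lemma integrable_cone_chi' : mu2.-integrable setT
  (EFin \o (fun p => Y p * (chi' p.1 * cone lam a b p.1 p.2))).
Proof.
have X0 p : ~ rectangle t0 t1 a b p -> chi' p.1 * cone lam a b p.1 p.2 = 0.
  by move=> /cone_rectangle[[e e']|[e e' e'']]; rewrite ?e' ?e; ring.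
apply: (@integrable_product (fun p => chi' p.1 * cone lam a b p.1 p.2)) => //.
  by apply: measurable_funM => //; exact: measurable_cone.
apply: continuous_rectangle_bounded X0.
apply: continuous_funM; last exact: continuous_cone.
by apply: continuous_fun_comp => // ?; exact: cvg_fst.
Qed.

End integrable_product.

(** Fubini with x integrated first, then the fundamental theorem of calculus. Together with its
    analogue in t, it lets constants be added to [u] and [f u] in the weak equation. *)
Lemma Rintegral_cone_test_x0 : \int[mu2]_p B p = 0.
Proof.
have iB : mu2.-integrable setT (EFin \o B).
  have := @integrable_cone_test_x (cst 1) 1 (measurable_cst _) _.
  rewrite (_ : (fun p => cst 1 p * B p) = B); last by apply/funext => p; rewrite /= mul1r.
  by apply => p; rewrite normr1.
rewrite /Rintegral -(integral12_prod_meas1 iB) (eq_integral (cst 0%E)) ?integral0// => t _.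
rewrite /fubini_F /=.
have [tt|tt] := boolP (t0 < t < t1); last first.
  rewrite (eq_integral (cst 0%E)) ?integral0// => x _.
  by rewrite /B /cone_test_x chi_out// mul0r.
have tge0 : 0 <= t by case/andP : tt => /(lt_trans t0_gt0)/ltW.
(* The interval is enlarged by 1 so that vanishing holds at its endpoints too: [cone_outside] speaks
   only of points outside the closed [a, b]. *)
have out x : ~~ (a - 1 < x < b + 1) -> ~~ (a <= x <= b).
  by apply: contra => /andP[? ?]; apply/andP; split; lra.
apply: (@integral_derive_compact_support _ (cone_test lam a b chi t) _ (a - 1) (b + 1)).
- by have := ab; lra.
- by move=> x; exact: is_derive_cone_test_x.
- have cx := @continuous_cone_test_x R lam a b chi chi' chi_derive.
  move=> x; apply: (@continuous2_cvg _ _ _ _ _ _ (cst t) id (cone_test_x lam a b chi)).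
  - exact: cx.
  - exact: cvg_cst.
  - exact: cvg_id.
- by move=> x /out /(cone_outside lam_ge0 tge0)[e _ _]; rewrite /cone_test e mulr0.
- by move=> x /out /(cone_outside lam_ge0 tge0)[_ e e']; rewrite /B /cone_test_x e e' subrr mulr0.
Qed.

Lemma Rintegral_cone_test_t0 : \int[mu2]_p A p = 0.
Proof.
have iA : mu2.-integrable setT (EFin \o A).
  have := @integrable_cone_test_t (cst 1) 1 (measurable_cst _) _.
  rewrite (_ : (fun p => cst 1 p * A p) = A); last by apply/funext => p; rewrite /= mul1r.
  by apply => p; rewrite normr1.
rewrite /Rintegral -(integral21_prod_meas1 iA) (eq_integral (cst 0%E)) ?integral0// => x _.
rewrite /fubini_G /=.
apply: (@integral_derive_compact_support _ (fun t => cone_test lam a b chi t x) _ t0 t1) => //.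
- by move=> t; exact: is_derive_cone_test_t.
- have cx := @continuous_cone_test_t R lam a b chi chi' chi_derive chi_cont.
  move=> t; apply: (@continuous2_cvg _ _ _ _ _ _ id (cst x) (cone_test_t lam a b chi chi')).
  - exact: cx.
  - exact: cvg_id.
  - exact: cvg_cst.
- by move=> t tt; rewrite /cone_test chi_out// mul0r.
- by move=> t tt; rewrite /A /cone_test_t chi_out// chi'_out//; ring.
Qed.

Variables (f u0 : R -> R) (u : R -> R -> R).
Hypothesis sol : entropy_solution f u0 u.
Hypothesis cf : continuous f.
Variable C : R.
Hypothesis C_ge0 : 0 <= C.
Hypothesis u_le : forall t, 0 <= t -> {ae mu, forall x, `|u t x| <= C}.
Variables k s : R.
Hypothesis f_lip : forall y, `|y| <= C -> `|f y - f k| <= lam * `|y - k|.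
Hypothesis s1 : `|s| <= 1.
Hypothesis chi_ge0 : forall t, 0 <= chi t.

(* s = 0 is Kruzhkov's entropy; s = 1 and s = -1 give twice the positive and the
   negative part of y - k. *)
Definition entropy y : R := `|y - k| + s * (y - k).
Definition entropy_flux y : R := (Num.sg (y - k) + s) * (f y - f k).

Let v := trunc u C.
Let mv : measurable_fun setT v.
Proof. by apply: measurable_trunc; exact: entropy_solution_measurable sol. Qed.

Lemma entropyE y : entropy y = (Num.sg (y - k) + s) * (y - k).
Proof. by rewrite /entropy mulrDl normrEsg. Qed.

Lemma entropy_ge0 y : 0 <= entropy y.
Proof.
have : `|s * (y - k)| <= `|y - k| by rewrite normrM ler_piMl.
by rewrite ler_norml /entropy => /andP[+ _]; lra.
Qed.

(** Entropy and flux share the factor [Num.sg (y - k) + s], so the Lipschitz bound on [f] passes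
    directly to the pair. *)
Lemma entropy_flux_le y : `|y| <= C -> `|entropy_flux y| <= lam * entropy y.
Proof.
move=> yC; rewrite -(ger0_norm (entropy_ge0 y)) entropyE /entropy_flux !normrM mulrCA.
by rewrite ler_wpM2l// f_lip.
Qed.

Let bndf : exists K : R, forall p, `|f (v p)| <= K.
Proof.
have : compact (f @` `[- C, C]).
  by apply: continuous_compact; [exact: continuous_subspaceT|exact: segment_compact].
move/(@compact_bounded R R^o) => [K [_ KX]]; exists (`|K| + 1) => p.
apply: (KX (`|K| + 1)); first by rewrite (le_lt_trans (ler_norm _))// ltrDl.
by exists (v p) => //=; rewrite in_itv/= -ler_norml; exact: trunc_le.
Qed.

Let mf : measurable_fun setT f.
Proof. exact: continuous_measurable_fun. Qed.

(** Kruzhkov's inequality combined with [s] times the weak equation gives the inequality for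
    [entropy]. The terms carrying derivatives of the cone have a favourable sign, and only the
    derivative of the time window remains. *)
Lemma entropy_cone_window :
  0 <= \int[mu2]_p (entropy (v p) * (chi' p.1 * cone lam a b p.1 p.2)).
Proof.
have [Kf Kf_] := bndf.
have vC p : `|v p| <= C by exact: trunc_le.
have tphi : test_function (cone_test lam a b chi).
  exact: (@test_function_cone_test R lam a b lam_ge0 chi chi' t0 t1).
have phi_ge0 t x : 0 <= cone_test lam a b chi t x.
  by rewrite mulr_ge0// cone_ge0.
have A0' p : ~ H p -> A p = 0 by move=> Hp; apply: A0 => /rectangle_upper.
have B0' p : ~ H p -> B p = 0 by move=> Hp; apply: B0 => /rectangle_upper.
have mu_u : measurable_fun H (fun p : TR * TR => u p.1 p.2).
  exact: entropy_solution_measurable sol.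
pose G y := Num.sg (y - k) * (f y - f k).
have mG : measurable_fun setT G.
  apply: measurable_funM; last exact: measurable_funB.
  by apply: measurableT_comp; [exact: measurable_sgr|exact: measurable_funB].
have mN : measurable_fun setT (fun y : R => `|y - k|).
  by apply: measurableT_comp => //; exact: measurable_funB.
have kru : 0 <= \int[mu2]_p (`|v p - k| * A p + G (v p) * B p).
  have := entropy_solution_Kruzhkov sol k tphi phi_ge0.
  rewrite -(Rintegral_trunc mu_u u_le mN mG mA mB A0' B0').
  congr (_ <= _); apply: eq_Rintegral => p _.
  by rewrite dt_cone_test// dx_cone_test.
have weak : \int[mu2]_p (v p * A p + f (v p) * B p) = 0.
  have := entropy_solution_weak sol tphi.
  have mid : measurable_fun setT (id : R -> R) by exact: measurable_id.
  rewrite -(Rintegral_trunc mu_u u_le mid mf mA mB A0' B0') => <-.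
  apply: eq_Rintegral => p _; by rewrite dt_cone_test// dx_cone_test.
have iY (Y : TR * TR -> R) (K : R) (Y' : TR * TR -> R) (K' : R) :
    measurable_fun setT Y -> measurable_fun setT Y' ->
    (forall p, `|Y p| <= K) -> (forall p, `|Y' p| <= K') ->
    mu2.-integrable setT (EFin \o (fun p => Y p * A p + Y' p * B p)).
  move=> mY mY' YK YK'.
  apply: eq_integrable (integrableD _ (integrable_cone_test_t mY YK)
    (integrable_cone_test_x mY' YK')) => //.
have mvk : measurable_fun setT (fun p => `|v p - k|).
  by apply: measurableT_comp => //; exact: measurable_funB.
have mGv : measurable_fun setT (fun p => G (v p)) by exact: measurableT_comp.
have mfv : measurable_fun setT (fun p => f (v p)) by exact: measurableT_comp.
have bvk p : `| `|v p - k| | <= C + `|k|.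
  by rewrite normr_id (le_trans (ler_normB _ _))// lerD.
have bG p : `|G (v p)| <= Kf + `|f k|.
  rewrite /G normrM normr_sg (le_trans (_ : _ <= 1 * `|f (v p) - f k|))//.
    by rewrite ler_wpM2r//; case: (_ != 0).
  by rewrite mul1r (le_trans (ler_normB _ _))// lerD.
have i1 := iY _ _ _ _ mvk mGv bvk bG.
have i2 := iY _ _ _ _ mv mfv vC Kf_.
have i3 : mu2.-integrable setT (EFin \o (fun p => cst (- (s * k)) p * A p + cst (- (s * f k)) p * B p)).
  by apply: (iY _ `|s * k| _ `|s * f k|) => // p; rewrite normrN.
have i2s : mu2.-integrable setT (EFin \o (fun p => s * (v p * A p + f (v p) * B p))).
  exact: eq_integrable (integrableZl measurableT s i2).
have i12 : mu2.-integrable setT (EFin \o (fun p =>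
   `|v p - k| * A p + G (v p) * B p + s * (v p * A p + f (v p) * B p))).
  exact: eq_integrable (integrableD measurableT i1 i2s).
have i123 : mu2.-integrable setT (EFin \o (fun p =>
   `|v p - k| * A p + G (v p) * B p + s * (v p * A p + f (v p) * B p) +
   (cst (- (s * k)) p * A p + cst (- (s * f k)) p * B p))).
  exact: eq_integrable (integrableD measurableT i12 i3).
have iA : mu2.-integrable setT (EFin \o (fun p => cst (- (s * k)) p * A p)).
  by apply: (@integrable_cone_test_t _ `|s * k|) => // p; rewrite normrN.
have iB : mu2.-integrable setT (EFin \o (fun p => cst (- (s * f k)) p * B p)).
  by apply: (@integrable_cone_test_x _ `|s * f k|) => // p; rewrite normrN.
have iA1 : mu2.-integrable setT (EFin \o A).
  have := @integrable_cone_test_t (cst 1) 1 (measurable_cst _) _.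
  rewrite (_ : (fun p => cst 1 p * A p) = A); last by apply/funext => p; rewrite /= mul1r.
  by apply => p; rewrite normr1.
have iB1 : mu2.-integrable setT (EFin \o B).
  have := @integrable_cone_test_x (cst 1) 1 (measurable_cst _) _.
  rewrite (_ : (fun p => cst 1 p * B p) = B); last by apply/funext => p; rewrite /= mul1r.
  by apply => p; rewrite normr1.
(* The added terms integrate to zero, being [s] times the weak equation and constants against
   derivatives of the test function; they complete Kruzhkov's integrand to that of [entropy] and
   [entropy_flux]. *)
have sum : \int[mu2]_p (`|v p - k| * A p + G (v p) * B p +
    s * (v p * A p + f (v p) * B p) +
   (cst (- (s * k)) p * A p + cst (- (s * f k)) p * B p)) =
   \int[mu2]_p (`|v p - k| * A p + G (v p) * B p).
  rewrite (RintegralD measurableT i12 i3) (RintegralD measurableT i1 i2s).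
  rewrite (RintegralZl s measurableT i2) weak mulr0 addr0.
  rewrite (RintegralD measurableT iA iB) /=.
  rewrite (RintegralZl _ measurableT iA1) (RintegralZl _ measurableT iB1).
  by rewrite Rintegral_cone_test_t0 Rintegral_cone_test_x0 !mulr0 !addr0.
rewrite -sum in kru; apply: (le_trans kru); apply: le_Rintegral => //.
  apply: (@integrable_cone_chi' _ (2 * (C + `|k|))).
    apply: measurable_funD => //; apply: measurable_funM => //.
    exact: measurable_funB.
  move=> p; rewrite /entropy (le_trans (ler_normD _ _))// mulrDl mul1r lerD//.
  by rewrite normrM (le_trans _ (bvk p))// normr_id ler_piMl.
move=> p _ /=.
have -> : `|v p - k| * A p + G (v p) * B p + s * (v p * A p + f (v p) * B p) +
   (- (s * k) * A p + - (s * f k) * B p) =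
   entropy (v p) * A p + entropy_flux (v p) * B p.
  by rewrite /entropy /entropy_flux /G; ring.
have /ler_normlP[q1 q2] := entropy_flux_le (vC p).
have e0 := entropy_ge0 (v p).
rewrite /A /B /cone_test_t /cone_test_x.
have := mulr_ge0 (chi_ge0 p.1) (cone_left_ge0 lam a b p.1 p.2).
have := mulr_ge0 (chi_ge0 p.1) (cone_right_ge0 lam a b p.1 p.2).
set X := chi p.1 * cone_right _ _ _ _ _; set Z := chi p.1 * cone_left _ _ _ _ _.
move=> X0 Z0.
(* the shrinking of the cone at speed lam absorbs the flux *)
have -> : entropy (v p) * (chi' p.1 * cone lam a b p.1 p.2 -
    lam * (chi p.1 * (cone_left lam a b p.1 p.2 + cone_right lam a b p.1 p.2))) +
    entropy_flux (v p) * (chi p.1 * (cone_left lam a b p.1 p.2 - cone_right lam a b p.1 p.2)) =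
    entropy (v p) * (chi' p.1 * cone lam a b p.1 p.2) -
    ((lam * entropy (v p) - entropy_flux (v p)) * Z +
     (lam * entropy (v p) + entropy_flux (v p)) * X) by rewrite /X /Z; ring.
rewrite gerBl addr_ge0// mulr_ge0//; lra.
Qed.

End entropy_cone.

(** * Domain of dependence *)

Section domain_of_dependence.
Context {R : realType}.
Local Notation TR := (measurableTypeR R).
Local Notation mu := (@lebesgue_measure R).
Local Notation mu2 := (mu \x mu)%E.

Lemma d_L1E (g h : R -> R) : d_L1 g h = (\int[mu]_x (`|g x - h x|)%:E)%E.
Proof. by rewrite /d_L1 Lnorm1; apply: eq_integral. Qed.

Lemma L1_measurable (g : R -> R) : L1 g -> measurable_fun (setT : set TR) g.
Proof.
by move=> /Lfun1_integrable/integrableP[+ _] => /measurable_EFinP.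
Qed.

Lemma integral_cst_itv (c x y : R) : x < y ->
  (\int[mu]_(t in `[x, y]) (cst c%:E t) = (c * (y - x))%:E)%E.
Proof.
move=> xy; rewrite integral_cst; last exact: measurable_itv.
by rewrite /= lebesgue_measure_itv/= lte_fin xy -EFinB -EFinM.
Qed.

Variables (lam a b : R).
Hypothesis lam_ge0 : 0 <= lam.
Hypothesis ab : a < b.
Variables (f u0 : R -> R) (u : R -> R -> R).
Hypothesis sol : entropy_solution f u0 u.
Hypothesis cf : continuous f.
Variable C : R.
Hypothesis C_ge0 : 0 <= C.
Hypothesis u_le : forall t : R, 0 <= t -> {ae mu, forall x, `|u t x| <= C}.
Variables k s : R.
Hypothesis f_lip : forall y, `|y| <= C -> `|f y - f k| <= lam * `|y - k|.
Hypothesis s1 : `|s| <= 1.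
Hypothesis u0_entropy : {ae mu, forall x, a <= x <= b -> entropy k s (u0 x) = 0}.

Let v := trunc u C.
Let eta := entropy k s.
Let eta_ge0 y : 0 <= eta y. Proof. exact: entropy_ge0. Qed.

Let meta : measurable_fun setT eta.
Proof.
have mk : measurable_fun setT (fun y : R => y - k) by exact: measurable_funB.
by apply: measurable_funD; [exact: measurableT_comp|exact: measurable_funM].
Qed.

Let mv : measurable_fun setT v.
Proof. by apply: measurable_trunc; exact: entropy_solution_measurable sol. Qed.

Let mu_t t : 0 <= t -> measurable_fun (setT : set TR) (u t).
Proof. by move=> t0; apply: L1_measurable; exact: entropy_solution_L1 sol _ t0. Qed.

(** Converts continuity of the solution in L1 into continuity of the integrated entropy, at the cost
    of a factor 2. *)
Lemma entropy_lip y z : eta y <= eta z + 2 * `|y - z|.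
Proof.
rewrite /eta /entropy.
have h1 : `|y - k| <= `|z - k| + `|y - z|.
  have -> : y - k = (z - k) + (y - z) by ring.
  exact: ler_normD.
have h2 : s * (y - k) <= s * (z - k) + `|y - z|.
  have -> : s * (y - k) = s * (z - k) + s * (y - z) by ring.
  by rewrite lerD2l (le_trans (ler_norm _))// normrM ler_piMl.
lra.
Qed.

Let weight (c : R -> R) (p : TR * TR) : R :=
  eta (v p) * (c p.1 * cone lam a b p.1 p.2).

Let mweight c : continuous c -> measurable_fun setT (weight c).
Proof.
move=> cc; apply: measurable_funM; first exact: measurableT_comp.
apply: measurable_funM; last exact: measurable_cone.
apply: measurableT_comp; last exact: measurable_fst.
exact: continuous_measurable_fun.
Qed.

Let weight_ge0 c : (forall t, 0 <= c t) -> forall p, 0 <= weight c p.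
Proof.
move=> c0 p; apply: mulr_ge0; first exact: eta_ge0.
by apply: mulr_ge0 => //; exact: cone_ge0.
Qed.

(** An approximate Dirac mass at the right of T; [window'] is the difference of two of these. *)
Definition bump (sg T : R) (t : R) : R := sg^-1 * tent ((t - T) / sg).

Let continuous_bump sg T : continuous (bump sg T).
Proof.
apply: continuous_funM; first exact: continuous_fun_cst.
apply: continuous_fun_comp; first exact: continuous_tent.
apply: continuous_funM; last exact: continuous_fun_cst.
by apply: continuous_funB; [move=> ?; exact: cvg_id|exact: continuous_fun_cst].
Qed.

Let bump_ge0 sg T t : 0 < sg -> 0 <= bump sg T t.
Proof.
by move=> s0; rewrite mulr_ge0 ?invr_ge0 ?(ltW s0)//; have /andP[] := tent_itv ((t - T) / sg).
Qed.

Let bump_eq0 sg T t : 0 < sg -> ~~ (T < t < T + sg) -> bump sg T t = 0.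
Proof.
move=> s0 h; rewrite /bump tent_eq0 ?mulr0//; apply: contra h.
rewrite ltr_pdivlMr// mul0r ltr_pdivrMr// mul1r => /andP[? ?].
by apply/andP; split; lra.
Qed.

Let bump_le sg T t : 0 < sg -> bump sg T t <= 2 / sg.
Proof.
move=> s0; rewrite /bump mulrC ler_wpM2r ?invr_ge0 ?(ltW s0)//.
by have /andP[] := tent_itv ((t - T) / sg).
Qed.

Let bump_ge sg T t : 0 < sg -> T + sg / 4 <= t <= T + 3 * sg / 4 -> sg^-1 <= bump sg T t.
Proof.
move=> s0 /andP[h1 h2]; rewrite /bump ler_peMr ?invr_ge0 ?(ltW s0)// tent_ge1//.
by rewrite ler_pdivlMr// ler_pdivrMr//; apply/andP; split; lra.
Qed.

Let eta_bounded : exists K, forall p, `|eta (v p)| <= K.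
Proof.
exists (2 * (C + `|k|)) => p.
have h : `|v p - k| <= C + `|k|.
  by rewrite (le_trans (ler_normB _ _))// lerD//; exact: trunc_le.
rewrite /eta /entropy (le_trans (ler_normD _ _))// mulrDl mul1r lerD ?normr_id//.
by rewrite normrM (le_trans _ h)// ler_piMl.
Qed.

Let iweight sg T : 0 < sg -> 0 < T -> mu2.-integrable setT (EFin \o weight (bump sg T)).
Proof.
move=> s0 T0; have [K HK] := eta_bounded.
(* The integrand involves [chi'] alone, which is the bump; [chi] can be taken constant 0. *)
apply: (@integrable_cone_chi' R lam a b lam_ge0 (cst 0) (bump sg T) T (T + sg) T0
  _ _ _ (fun p => eta (v p)) K).
- exact: continuous_bump.
- by [].
- by move=> t; exact: bump_eq0.
- exact: measurableT_comp.
- exact: HK.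
Qed.

Lemma weight_decreasing sg T delta : 0 < sg -> 2 * sg <= T -> 0 < delta ->
  (\int[mu2]_p (weight (bump delta T) p)%:E <= \int[mu2]_p (weight (bump sg sg) p)%:E)%E.
Proof.
move=> s0 sT d0.
have T0 : 0 < T by lra.
have i1 := iweight d0 T0; have i2 := iweight s0 s0.
have := @entropy_cone_window R lam a b lam_ge0 ab (window sg T delta) (window' sg T delta)
  sg (T + delta) s0 _ (is_derive_window sg T delta) (@continuous_window' _ sg T delta)
  (fun t => @window_eq0 _ sg T delta t s0 sT d0) _ f u0 u sol cf C C_ge0 u_le k s f_lip s1
  (fun t => @window_ge0 _ sg T delta t s0 sT d0).
have h1 : sg < T + delta by lra.
have h2 t : ~~ (sg < t < T + delta) -> window' sg T delta t = 0.
  move=> h; have -> : window' sg T delta t = bump sg sg t - bump delta T t by [].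
  rewrite !bump_eq0 ?subrr//; apply: contra h => /andP[? ?]; apply/andP; split; lra.
move=> /(_ h1 h2).
rewrite (_ : \int[_]_p _ = \int[mu2]_p (weight (bump sg sg) p - weight (bump delta T) p)); last first.
  by apply: eq_Rintegral => p _; rewrite /weight /window' /bump /eta /v; ring.
rewrite (RintegralB measurableT i2 i1) subr_ge0 -lee_fin !fineK//.
- exact: (integrable_fin_num measurableT i2).
- exact: (integrable_fin_num measurableT i1).
Qed.

(** The bump is at most 2/sg on a time interval of length sg, the cone at most (b - a)^4, and the
    entropy at most 2 |u t - u 0| on [a, b], where the entropy of the datum vanishes; hence the
    constant 4. *)
Lemma weight_initial sg kap : 0 < sg -> 0 <= kap ->
  (forall t : R, 0 < t <= 2 * sg -> (d_L1 (u t) (u 0) <= kap%:E)%E) ->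
  (\int[mu2]_p (weight (bump sg sg) p)%:E <= (4 * (b - a) ^+ 4 * kap)%:E)%E.
Proof.
move=> s0 kap0 hk.
have ba : 0 < b - a by rewrite subr_gt0.
set K := 2 / sg * (b - a) ^+ 4 * 2.
have K0 : 0 <= K by rewrite !mulr_ge0 ?invr_ge0 ?exprn_ge0 ?(ltW s0)// ltW.
have mw := mweight (@continuous_bump sg sg).
have w0 := weight_ge0 (fun t => bump_ge0 sg t s0).
have mwE : measurable_fun setT (EFin \o weight (bump sg sg)) by exact/measurable_EFinP.
have w0E p : (0 <= (EFin \o weight (bump sg sg)) p)%E by rewrite lee_fin.
rewrite (fubini_tonelli1 _ mwE w0E).
have mF := @measurable_fun_fubini_tonelli_F _ _ _ _ _ mu _ mwE w0E.
pose D := `[sg, 2 * sg]%classic : set TR.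
have mD : measurable D by exact: measurable_itv.
have -> : (4 * (b - a) ^+ 4 * kap)%:E = (\int[mu]_(t in D) (cst (K * kap)%:E t))%E.
  by rewrite integral_cst_itv; [congr EFin; rewrite /K; field; rewrite gt_eqF|lra].
rewrite [leRHS]integral_mkcond; apply: ge0_le_integral => //.
- by move=> t _; apply: integral_ge0 => x _.
- apply: (measurable_restrictT _ mD).1; exact: measurable_cst.
move=> t _; rewrite patchE /fubini_F; case: ifPn => [|].
  rewrite inE /D /= in_itv/= => /andP[t1 t2].
  have t0 : 0 < t by lra.
  apply: (@le_trans _ _ (\int[mu]_x (K%:E * (`|u t x - u 0 x|)%:E))%E); last first.
    rewrite ge0_integralZl_EFin//.
    - rewrite -d_L1E /= (EFinM K kap); apply: lee_wpmul2l; first by rewrite lee_fin.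
      by apply: hk; rewrite t0.
    - apply/measurable_EFinP; apply: measurableT_comp => //.
      by apply: measurable_funB; apply: mu_t => //; exact: ltW.
  apply: ae_ge0_le_integral => //.
  - by move=> x _; rewrite lee_fin.
  - exact: (@measurable_fun_pair2 _ _ _ TR TR _ _ t mwE).
  - by move=> x _; rewrite -EFinM lee_fin mulr_ge0.
  - apply/measurable_EFinP; apply: measurable_funM => //; apply: measurableT_comp => //.
    by apply: measurable_funB; apply: mu_t => //; exact: ltW.
  have h3 : {ae mu, forall x, a <= x <= b -> eta (u 0 x) = 0}.
    by apply: ae_imp2 (entropy_solution_initial sol) u0_entropy => x ->.
  apply: ae_imp2 (trunc_section u_le t0) h3 => x vx e0 _.
  rewrite lee_fin /weight /= {1}/v vx.
  have [xab|/(cone_outside lam_ge0 (ltW t0))[-> _ _]] := boolP (a <= x <= b); last first.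
    by rewrite !mulr0 mulr_ge0.
  have := entropy_lip (u t x) (u 0 x); rewrite e0// add0r => h.
  have h' : bump sg sg t * cone lam a b t x <= 2 / sg * (b - a) ^+ 4.
    rewrite ler_pM ?cone_ge0 ?bump_ge0 ?bump_le//; apply: cone_le => //; exact: ltW.
  have h0 : 0 <= bump sg sg t * cone lam a b t x.
    by apply: mulr_ge0; [exact: bump_ge0|exact: cone_ge0].
  apply: (le_trans (ler_pM (eta_ge0 _) h0 h h')).
  by rewrite /K; lra.
rewrite notin_setE /D /= in_itv/= => tD.
rewrite (eq_integral (cst 0%E)) ?integral0// => x _ /=.
rewrite /weight /= bump_eq0 ?mul0r ?mulr0//.
by apply/negP => /andP[? ?]; apply: tD; apply/andP; split; lra.
Qed.

(** On the middle half of [T, T + delta] the bump is at least 1/delta. During that time the cone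
    shrinks by at most [lam * delta <= d], so a margin 2d at time T leaves a distance d to its edges
    and a weight of at least d^4. *)
Lemma weight_final (T delta d e : R) : 0 < T -> 0 < delta -> 0 < d -> 0 <= e ->
  lam * delta <= d ->
  (forall t : R, T <= t <= T + delta ->
    (e%:E <= \int[mu]_(x in `[(a + lam * T + 2 * d)%R, (b - lam * T - 2 * d)%R])
       (eta (u t x))%:E)%E) ->
  ((d ^+ 4 * e / 2)%:E <= \int[mu2]_p (weight (bump delta T) p)%:E)%E.
Proof.
move=> T0 d0 dd0 e0 ld he.
have mw := mweight (@continuous_bump delta T).
have w0 := weight_ge0 (fun t => bump_ge0 T t d0).
have mwE : measurable_fun setT (EFin \o weight (bump delta T)) by exact/measurable_EFinP.
have w0E p : (0 <= (EFin \o weight (bump delta T)) p)%E by rewrite lee_fin.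
rewrite (fubini_tonelli1 _ mwE w0E).
have mF := @measurable_fun_fubini_tonelli_F _ _ _ _ _ mu _ mwE w0E.
pose D := `[T + delta / 4, T + 3 * delta / 4]%classic : set TR.
have mD : measurable D by exact: measurable_itv.
set K := delta^-1 * d ^+ 4.
have K0 : 0 <= K by rewrite mulr_ge0 ?invr_ge0 ?exprn_ge0 ?(ltW d0)// ltW.
have -> : (d ^+ 4 * e / 2)%:E = (\int[mu]_(t in D) (cst (K * e)%:E t))%E.
  by rewrite integral_cst_itv; [congr EFin; rewrite /K; field; rewrite gt_eqF|lra].
rewrite integral_mkcond; apply: ge0_le_integral => //.
- by move=> t _; apply: erestrict_ge0 => ? _; rewrite /= lee_fin mulr_ge0.
- apply: (measurable_restrictT _ mD).1; exact: measurable_cst.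
move=> t _; rewrite patchE /fubini_F; case: ifPn => [|_]; last first.
  by apply: integral_ge0 => x _.
rewrite inE /D /= in_itv/= => /andP[t1 t2].
have t0 : 0 < t by lra.
pose I := `[a + lam * T + 2 * d, b - lam * T - 2 * d]%classic : set TR.
have mI : measurable I by exact: measurable_itv.
have mut : measurable_fun (setT : set TR) (fun x => eta (u t x)).
  by apply: measurableT_comp => //; apply: mu_t; exact: ltW.
apply: (@le_trans _ _ (\int[mu]_(x in I) (K%:E * (eta (u t x))%:E))%E).
  rewrite ge0_integralZl_EFin//.
  - rewrite /= (EFinM K e); apply: lee_wpmul2l; first by rewrite lee_fin.
    apply: he; apply/andP; split; lra.
  - by move=> x _; rewrite lee_fin.
  - by apply/measurable_EFinP; exact: measurable_funTS.
rewrite integral_mkcond; apply: ae_ge0_le_integral => //.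
- by move=> x _; apply: erestrict_ge0 => ? _; rewrite -EFinM lee_fin mulr_ge0.
- apply: (measurable_restrictT _ mI).1; apply/measurable_EFinP.
  by apply: measurable_funM => //; exact: measurable_funTS.
- by move=> x _; rewrite lee_fin.
- exact: (@measurable_fun_pair2 _ _ _ TR TR _ _ t mwE).
apply: ae_imp (trunc_section u_le t0) => x vx _.
rewrite patchE; case: ifPn => [|_]; last by rewrite lee_fin.
rewrite inE /I /= in_itv/= => /andP[x1 x2].
rewrite -EFinM lee_fin /weight /= {1}/v vx mulrC ler_wpM2l ?eta_ge0//.
have lt : lam * t <= lam * T + d.
  have : lam * (t - T) <= lam * delta by rewrite ler_wpM2l//; lra.
  by rewrite mulrBr; lra.
rewrite ler_pM ?invr_ge0 ?(ltW d0) ?exprn_ge0 ?(ltW dd0)//.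
- by apply: bump_ge => //; apply/andP; split.
- by apply: cone_ge; [exact: ltW| |]; lra.
Qed.

Lemma L1_continuity t1 kap : 0 <= t1 -> 0 < kap ->
  exists2 delta : R, 0 < delta & forall t : R, 0 <= t -> `|t - t1| < delta ->
    (d_L1 (u t) (u t1) <= kap%:E)%E.
Proof.
move=> t1_ge0 kap0.
have := entropy_solution_continuous sol t1_ge0.
move=> /(_ [set y | (y < kap%:E)%E]) /=.
have nb : nbhs (0%E : \bar R) [set y | (y < kap%:E)%E].
  by apply: open_nbhs_nbhs; split; [exact: open_ereal_lt_ereal|rewrite /= lte_fin].
move=> /(_ nb); rewrite /fmap /within /= => /nbhs_ballP[delta /= d0 hd].
exists delta => // t t0 td; apply: ltW; apply: (hd t) => //=.
by rewrite /ball /= distrC.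
Qed.

(** By contradiction: positive entropy at T persists for a short time by continuity in L1, so the
    weight after T is bounded below, while the weight near time 0 can be made as small as
    desired. *)
Lemma entropy_vanish_margin T d : 0 < T -> 0 < d ->
  {ae mu, forall x, a + lam * T + 2 * d <= x <= b - lam * T - 2 * d -> eta (u T x) = 0}.
Proof.
move=> T0 d0.
pose I := `[a + lam * T + 2 * d, b - lam * T - 2 * d]%classic : set TR.
have mI : measurable I by exact: measurable_itv.
have met t : 0 <= t -> measurable_fun I (fun x => eta (u t x)).
  by move=> t0; apply: measurable_funTS; apply: measurableT_comp => //; exact: mu_t.
suff E0 : (\int[mu]_(x in I) (eta (u T x))%:E = 0)%E.
  have : (\int[mu]_(x in I) `|(EFin \o (fun x => eta (u T x))) x| = 0)%E.
    by rewrite -[RHS]E0; apply: eq_integral => x _; rewrite /= ger0_norm.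
  have mE : measurable_fun I (EFin \o (fun x => eta (u T x))).
    by apply/measurable_EFinP; exact: met (ltW T0).
  move=> /((ae_eq_integral_abs mu mI mE).1); apply: ae_imp => x h xI.
  by apply/EFin_inj/h; rewrite /I /= in_itv.
apply/eqP; apply: contrapT => /negP E0.
have Ege0 : (0 <= \int[mu]_(x in I) (eta (u T x))%:E)%E.
  by apply: integral_ge0 => x _; rewrite lee_fin.
(* The integral is not known to be finite here, so a positive real below it is used instead. *)
have [e e0 he] : exists2 e : R, 0 < e & (e%:E <= \int[mu]_(x in I) (eta (u T x))%:E)%E.
  move: E0 Ege0; case: (\int[mu]_(x in I) _)%E => [r| |//].
    by rewrite eqe lee_fin => r0 r0'; exists r => //; rewrite lt_neqAle eq_sym r0.
  by move=> _ _; exists 1 => //; rewrite leey.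
have ba : 0 < b - a by rewrite subr_gt0.
(* By [entropy_lip], a distance e/4 in L1 costs at most e/2 of entropy, leaving e/2. *)
have [dl1 dl1_gt0 h1] := L1_continuity (ltW T0) (divr_gt0 e0 (ltr0n R 4)).
(* Chosen to make the initial bound d^4 e / 8, half of the final lower bound d^4 e / 4. *)
pose kap := d ^+ 4 * e / (32 * (b - a) ^+ 4).
have kap0 : 0 < kap by rewrite divr_gt0 ?mulr_gt0 ?exprn_gt0.
have [dl0 dl0_gt0 h0] := L1_continuity (lexx 0) kap0.
(* The first term keeps the times in the range of [h1], the second ensures [lam * delta <= d]; the
   shift by 1 covers [lam = 0]. *)
pose delta := Num.min (dl1 / 2) (d / (lam + 1)).
have l1 : 0 < lam + 1 by have := lam_ge0; lra.
have delta0 : 0 < delta by rewrite lt_min !divr_gt0.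
pose sg := Num.min (T / 2) (dl0 / 4).
have sg0 : 0 < sg by rewrite lt_min !divr_gt0.
have sgT : 2 * sg <= T.
  have : sg <= T / 2 by rewrite ge_min lexx.
  by lra.
have delta1 : delta <= dl1 / 2 by rewrite ge_min lexx.
have lamd : lam * delta <= d.
  have : delta <= d / (lam + 1) by rewrite ge_min lexx orbT.
  rewrite ler_pdivlMr//; apply: le_trans.
  by rewrite mulrDr mulr1 mulrC lerDl ltW.
have low := @weight_final T delta d (e / 2) T0 delta0 d0 (divr_ge0 (ltW e0) (ler0n _ _)) lamd.
have up := @weight_initial sg kap sg0 (ltW kap0).
have dec := weight_decreasing sg0 sgT delta0.
have {up} up : (\int[mu2]_p (weight (bump sg sg) p)%:E <= (4 * (b - a) ^+ 4 * kap)%:E)%E.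
  apply: up => t /andP[t0 ts]; apply: h0; first exact: ltW.
  have : sg <= dl0 / 4 by rewrite ge_min lexx orbT.
  by rewrite subr0 ger0_norm ?(ltW t0)//; lra.
have {low} low : ((d ^+ 4 * (e / 2) / 2)%:E <= \int[mu2]_p (weight (bump delta T) p)%:E)%E.
  apply: low => t /andP[Tt tT].
  have t0 : 0 <= t by lra.
  have dT : (d_L1 (u t) (u T) <= (e / 4)%:E)%E.
    by apply: h1 => //; rewrite ger0_norm; lra.
  have -> : e / 2 = e - 2 * (e / 4) by field.
  rewrite EFinB leeBlDr//; apply: (le_trans he).
  apply: (@le_trans _ _ (\int[mu]_(x in I) ((eta (u t x))%:E + (2 * `|u t x - u T x|)%:E))%E).
    apply: ge0_le_integral => //.
    - by move=> x _; rewrite lee_fin.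
    - by apply/measurable_EFinP; exact: met (ltW T0).
    - apply/measurable_EFinP; apply: measurable_funD; first exact: met.
      apply: measurable_funM => //; apply: measurableT_comp => //; apply: measurable_funTS.
      by apply: measurable_funB; apply: mu_t => //; exact: ltW.
    - by move=> x _; rewrite -EFinD lee_fin distrC; exact: entropy_lip.
  have mdiff : measurable_fun (setT : set TR) (fun x => (`|u t x - u T x|)%:E).
    apply/measurable_EFinP; apply: measurableT_comp => //.
    by apply: measurable_funB; apply: mu_t => //; exact: ltW.
  rewrite ge0_integralD//.
  - rewrite leeD2l//.
    under eq_integral do rewrite EFinM.
    rewrite ge0_integralZl_EFin//; last exact: measurable_funTS.
    rewrite (EFinM 2); apply: lee_wpmul2l; first by rewrite lee_fin.
    by apply: le_trans dT; rewrite d_L1E; exact: ge0_subset_integral.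
  - by move=> x _; rewrite lee_fin.
  - by apply/measurable_EFinP; exact: met.
  - apply/measurable_EFinP; apply: measurable_funM => //.
    by apply: measurable_funTS; apply/measurable_EFinP.
have := le_trans low (le_trans dec up); rewrite lee_fin /kap.
have -> : 4 * (b - a) ^+ 4 * (d ^+ 4 * e / (32 * (b - a) ^+ 4)) = d ^+ 4 * e / 8.
  by field; rewrite gt_eqF.
have : 0 < d ^+ 4 * e by rewrite mulr_gt0// exprn_gt0.
have -> : d ^+ 4 * (e / 2) / 2 = d ^+ 4 * e / 4 by field.
by move=> h h'; lra.
Qed.

(** The open cone section is a countable union of closed sections with margins 2/(n + 1). *)
Lemma entropy_vanish T : 0 < T ->
  {ae mu, forall x, a + lam * T < x < b - lam * T -> eta (u T x) = 0}.
Proof.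
move=> T0.
have /ae_forall : forall n, {ae mu, forall x, a + lam * T + 2 * n.+1%:R^-1 <= x <=
    b - lam * T - 2 * n.+1%:R^-1 -> eta (u T x) = 0}.
  by move=> n; apply: entropy_vanish_margin => //; rewrite invr_gt0.
apply: ae_imp => x hx /andP[x1 x2].
pose r := Num.min (x - (a + lam * T)) (b - lam * T - x) / 2.
have r0 : 0 < r by rewrite divr_gt0// lt_min !subr_gt0 x1 x2.
have [n nr] : exists n : nat, n.+1%:R^-1 < r.
  have [N _ hN] := near_infty_natSinv_lt (PosNum r0).
  by exists N; apply: hN => /=.
apply: (hx n); clear hx.
have : Num.min (x - (a + lam * T)) (b - lam * T - x) <= x - (a + lam * T) by rewrite ge_min lexx.
have : Num.min (x - (a + lam * T)) (b - lam * T - x) <= b - lam * T - x by rewrite ge_min lexx orbT.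
have : 2 * r = Num.min (x - (a + lam * T)) (b - lam * T - x) by rewrite /r; field.
move: nr; move: (n.+1%:R^-1) (Num.min _ _) => w m; clearbody r => h1 h2 h3 h4.
by apply/andP; split; lra.
Qed.

End domain_of_dependence.

(** * Maximum principle and finite speed of propagation *)

Section flux.
Context {R : realType}.
Variable f : R -> R.
Hypothesis f_C2 : C2_function f.

Lemma C2_continuous : continuous f.
Proof.
by case: f_C2 => df _ _ x; apply: differentiable_continuous; apply/derivable1_diffP.
Qed.

Lemma C2_derive_continuous : continuous f^`().
Proof.
by case: f_C2 => _ df _ x; apply: differentiable_continuous; apply/derivable1_diffP.
Qed.

Lemma le_max_speed (C v : R) : `|v| <= C -> `|f^`() v| <= max_speed f C.
Proof.
move=> vC; apply: ub_le_sup; last by exists v => //=; rewrite in_itv/= -ler_norml.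
have : compact (f^`() @` `[- C, C]).
  apply: continuous_compact; last exact: segment_compact.
  by apply: continuous_subspaceT; exact: C2_derive_continuous.
move/(@compact_bounded R R^o) => [K [_ KX]]; exists (`|K| + 1) => _ [y yC <-].
apply: (KX (`|K| + 1)); last by exists y.
by rewrite (le_lt_trans (ler_norm _))// ltrDl.
Qed.

Lemma max_speed_ge0 (C : R) : 0 <= C -> 0 <= max_speed f C.
Proof. by move=> C0; apply: le_trans (@le_max_speed C 0 _); rewrite ?normr0. Qed.

Lemma max_speed_lipschitz (C y z : R) : `|y| <= C -> `|z| <= C ->
  `|f y - f z| <= max_speed f C * `|y - z|.
Proof.
wlog yz : y z / z <= y => [hwlog yC zC|yC zC].
  have [|/ltW] := leP z y; first by move=> ?; exact: hwlog.
  by move=> ?; rewrite distrC (distrC y); exact: hwlog.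
have df (x : R) : is_derive x 1 f (f^`() x).
  by rewrite derive1E; apply: derivableP; case: f_C2.
have [|c cyz ->] := @MVT_segment R f f^`() z y yz (fun x _ => df x).
  by apply: continuous_subspaceT; exact: C2_continuous.
rewrite normrM ler_wpM2r// le_max_speed//.
move: cyz yC zC; rewrite in_itv/= !ler_norml => /andP[? ?] /andP[? ?] /andP[? ?].
by apply/andP; split; lra.
Qed.

End flux.

(** * Initial data: essential support and integrability *)

Section initial_data.
Context {R : realType}.
Local Notation TR := (measurableTypeR R).
Local Notation mu := (@lebesgue_measure R).

Lemma ae_neq (c : R) : {ae mu, forall x, x <> c}.
Proof.
exists [set c]; split; [exact: measurable_set1|exact: lebesgue_measure_set1|].
by move=> x /= /contrapT.
Qed.

(** The complement of the essential support is a possibly uncountable union of open sets where [g]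
    vanishes almost everywhere. Each of its points lies in an interval with rational endpoints
    having the same property, and these intervals are countably many. *)
Lemma ess_support_ae (g : R -> R) : {ae mu, forall x, ~ ess_support g x -> g x = 0}.
Proof.
pose vanish (p : rat * rat) :=
  {ae mu, forall x, ratr p.1 < x < ratr p.2 -> g x = 0}.
have /ae_forall : forall n, {ae mu, forall x,
    if unpickle n is Some p then vanish p -> ratr p.1 < x < ratr p.2 -> g x = 0 else True}.
  move=> n; case: (unpickle n) => [p|]; last by apply: aeW.
  have [hp|hp] := pselect (vanish p); last by apply: aeW => x /hp.
  by apply: ae_imp hp => x gx _.
apply: ae_imp => x hx; rewrite /ess_support /= => /contrapT[U [oU gU] Ux].
have /nbhs_ballP[e /= e0 he] : nbhs x U by apply: open_nbhs_nbhs; split.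
have xe : x - e < x by rewrite ltrBlDr ltrDl.
have [p] := rat_in_itvoo xe.
rewrite in_itv/= => /andP[p1 p2].
have ex : x < x + e by rewrite ltrDl.
have [q] := rat_in_itvoo ex.
rewrite in_itv/= => /andP[q1 q2].
have := hx (pickle (p, q)); rewrite pickleK /=; apply; last by rewrite p2 q1.
apply: ae_imp gU => y gy /andP[py yq]; apply: gy; apply: he.
by rewrite /ball /= ltr_norml; apply/andP; split; lra.
Qed.

Variables L M : R.
Hypothesis L_gt0 : 0 < L.

Lemma initial_data_measurable (u0 : R -> R) : initial_data L M u0 ->
  measurable_fun (setT : set TR) u0.
Proof. by move=> [+ _ _]; rewrite /Linfty /= inE => /andP[+ _]; rewrite inE. Qed.

Lemma initial_data_le (u0 : R -> R) : initial_data L M u0 ->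
  {ae mu, forall x, `|u0 x| <= M}.
Proof. by move=> [_ _ /norm_Linfty_leP]. Qed.

Lemma initial_data_support (u0 : R -> R) : initial_data L M u0 ->
  {ae mu, forall x, L < `|x| -> u0 x = 0}.
Proof.
move=> [_ sL _]; apply: ae_imp (ess_support_ae u0) => x + xL; apply.
by move=> /sL /=; rewrite in_itv/= -ler_norml leNgt xL.
Qed.

Lemma initial_data_L1 (u0 : R -> R) : initial_data L M u0 -> L1 u0.
Proof.
move=> u0P; apply/Lfun1_integrable/integrableP; split.
  by apply/measurable_EFinP; exact: initial_data_measurable.
apply: (@le_lt_trans _ _ (\int[mu]_(x in `[(- L)%R, L]) (cst (`|M|)%:E x))%E); last first.
  by rewrite integral_cst_itv ?ltry// gtrN.
rewrite [leRHS]integral_mkcond; apply: ae_ge0_le_integral => //.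
- apply/measurable_EFinP; apply: measurableT_comp => //.
  exact: initial_data_measurable.
- by move=> x _; apply: erestrict_ge0 => ? _; rewrite /= lee_fin.
- by apply: (measurable_restrictT _ _).1; [exact: measurable_itv|exact: measurable_cst].
apply: ae_imp2 (initial_data_le u0P) (initial_data_support u0P) => x h1 h2 _.
rewrite patchE; case: ifPn => [_|]; first by rewrite /= lee_fin (le_trans h1)// ler_norm.
rewrite notin_setE/= in_itv/= -ler_norml => /negP; rewrite -ltNge => /h2 ->.
by rewrite normr0.
Qed.

End initial_data.

Section entropy_solution_bounds.
Context {R : realType}.
Local Notation mu := (@lebesgue_measure R).
Variables (f u0 : R -> R) (u : R -> R -> R) (M : R).
Hypothesis f_C2 : C2_function f.
Hypothesis sol : entropy_solution f u0 u.
Hypothesis M_ge0 : 0 <= M.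
Hypothesis u0_le : {ae mu, forall x, `|u0 x| <= M}.

Lemma maximum_principle (t : R) : 0 <= t -> {ae mu, forall x, `|u t x| <= M}.
Proof.
rewrite le_eqVlt => /predU1P[<-|t0].
  by apply: ae_imp2 (entropy_solution_initial sol) u0_le => x ->.
have [C0 hC0] := entropy_solution_bounded sol.
(* The bound by M being the goal, the speed is first taken on the range given by the a priori bound.
   This possibly larger speed is harmless, since intervals of arbitrary length are available. *)
pose C := Num.max C0 M.
have MC : M <= C by rewrite le_max lexx orbT.
have C_ge0 : 0 <= C by exact: le_trans MC.
have u_le s : 0 <= s -> {ae mu, forall x, `|u s x| <= C}.
  move=> /hC0/norm_Linfty_leP; apply: ae_imp => x /le_trans; apply.
  by rewrite le_max lexx.
have lam_ge0 := max_speed_ge0 f_C2 C_ge0.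
set lam := max_speed f C in lam_ge0.
have key (k s : R) : `|k| <= C -> `|s| <= 1 ->
    (forall y, `|y| <= M -> entropy k s y = 0) ->
    {ae mu, forall x, entropy k s (u t x) = 0}.
  move=> kC s1 hk.
  have lip y : `|y| <= C -> `|f y - f k| <= lam * `|y - k|.
    by move=> yC; exact: max_speed_lipschitz.
  have /ae_forall : forall n : nat, {ae mu, forall x,
      - n.+1%:R + lam * t < x < n.+1%:R - lam * t -> entropy k s (u t x) = 0}.
    move=> n; have nn : - n.+1%:R < n.+1%:R :> R by rewrite gtrN// ltr0n.
    apply: (entropy_vanish lam_ge0 nn sol (C2_continuous f_C2) C_ge0 u_le lip s1 _ t0).
    by apply: ae_imp u0_le => x /hk.
  apply: ae_imp => x hx.
  have [n xn] : exists n : nat, `|x| + lam * t < n%:R.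
    exists (Num.trunc (`|x| + lam * t)).+1.
    by rewrite truncnS_gt.
  apply: (hx n); have xx := ler_norm x; have xx' := ler_norm (- x); rewrite normrN in xx'.
  have : n%:R <= n.+1%:R :> R by rewrite ler_nat.
  by move: (n.+1%:R) => m mn; apply/andP; split; lra.
have k1 := key M 1; have k2 := key (- M) (-1).
apply: ae_imp2 (k1 _ _ _) (k2 _ _ _).
- move=> x; rewrite /entropy mul1r mulN1r => h1 h2; rewrite ler_norml; apply/andP; split.
    have := normr_ge0 (u t x - - M); have := ler_norm (- (u t x - - M)); rewrite normrN; lra.
  have := ler_norm (u t x - M); lra.
- by rewrite ger0_norm.
- by rewrite normr1.
- by move=> y; rewrite ler_norml /entropy => /andP[? ?]; rewrite ler0_norm ?mul1r; lra.
- by rewrite normrN ger0_norm.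
- by rewrite normrN normr1.
- by move=> y; rewrite ler_norml /entropy => /andP[? ?]; rewrite ger0_norm ?mulN1r; lra.
Qed.

(** The maximum principle now confines the solution to [-M, M], so the speed [max_speed f M] is
    admissible. Cones based on [L, L + n + 1] and on [-L - n - 1, -L] exhaust the two outer
    regions. *)
Lemma finite_propagation_speed (L T : R) : 0 < T ->
  {ae mu, forall x, L < `|x| -> u0 x = 0} ->
  {ae mu, forall x, L + T * max_speed f M < `|x| -> u T x = 0}.
Proof.
move=> T0 supp.
have lam_ge0 := max_speed_ge0 f_C2 M_ge0.
set lam := max_speed f M in lam_ge0 *.
have lip y : `|y| <= M -> `|f y - f 0| <= lam * `|y - 0|.
  by move=> yC; apply: max_speed_lipschitz => //; rewrite normr0.
have s1 : `|0 : R| <= 1 by rewrite normr0.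
have key (a b : R) : a < b -> (forall x, a < x < b -> L < `|x|) ->
    {ae mu, forall x, a + lam * T < x < b - lam * T -> u T x = 0}.
  move=> ab hab.
  have h0 : {ae mu, forall x, a <= x <= b -> entropy 0 0 (u0 x) = 0}.
    (* The datum is known to vanish only for [L < |x|], which may fail at the endpoints of the
       base. *)
    have nab : {ae mu, forall x, x <> a /\ x <> b}.
      by apply: ae_imp2 (ae_neq a) (ae_neq b).
    apply: ae_imp2 supp nab => x u0x [/eqP xa /eqP xb] /andP[ax xb'].
    rewrite /entropy u0x ?subr0 ?normr0 ?mul0r ?addr0//.
    by apply: hab; rewrite !lt_neqAle ax xb' xb eq_sym xa.
  have := entropy_vanish lam_ge0 ab sol (C2_continuous f_C2) M_ge0 maximum_principle lip s1 h0 T0.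
  apply: ae_imp => x h /h; rewrite /entropy mul0r addr0 subr0.
  by move=> /eqP; rewrite normr_eq0 => /eqP.
have /ae_forall h1 : forall n : nat, {ae mu, forall x,
    L + lam * T < x < L + n.+1%:R - lam * T -> u T x = 0}.
  move=> n; apply: key; first by rewrite ltrDl ltr0n.
  by move=> x /andP[Lx _]; rewrite (lt_le_trans Lx)// ler_norm.
have /ae_forall h2 : forall n : nat, {ae mu, forall x,
    - L - n.+1%:R + lam * T < x < - L - lam * T -> u T x = 0}.
  move=> n; apply: key; first by rewrite ltrBlDr ltrDl ltr0n.
  by move=> x /andP[_ Lx]; have := ler_norm (- x); rewrite normrN; lra.
apply: ae_imp2 h1 h2 => x h1 h2; rewrite mulrC => xL.
have [n xn] : exists n : nat, `|x| + `|L| + lam * T < n%:R.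
  exists (Num.trunc (`|x| + `|L| + lam * T)).+1.
  by rewrite truncnS_gt.
have Ln := ler_norm (- L); rewrite normrN in Ln.
have : n%:R <= n.+1%:R :> R by rewrite ler_nat.
move: (h1 n) (h2 n); clear h1 h2 => h1 h2.
have [x0|x0] := leP 0 x.
  move=> nn; apply: h1; move: xL xn nn; rewrite (ger0_norm x0).
  by move: (n.+1%:R) => m ? ? ?; apply/andP; split; lra.
move=> nn; apply: h2; move: xL xn nn; rewrite (ltr0_norm x0).
by move: (n.+1%:R) => m ? ? ?; apply/andP; split; lra.
Qed.

End entropy_solution_bounds.

(** * Large jumps and coding of integer paths *)

Section Psi.
Context {R : realType}.
Variables (f : R -> R) (M : R).

Lemma cst0_convex_minorant : convex_minorants f M (cst 0).
Proof.
split => //.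
- by move=> t x y _ _; rewrite convRE !mulr0 addr0.
- move=> h _; apply: le_ereal_inf_tmp => _ [x _ <-].
  by apply: le_ereal_inf_tmp => _ [g _ <-]; exact: Lnorm_ge0.
Qed.

Lemma Phi_ge0 (x : R) : (0 <= Phi f M x)%E.
Proof. by apply: ereal_sup_ubound; exists (cst 0) => //; exact: cst0_convex_minorant. Qed.

(** Each convex minorant vanishes at 0, and h/2 is the convex combination of y/2 and 0 with weight
    h/y on y/2. *)
Lemma Phi_le_scale (h y : R) : 0 < h -> h <= y ->
  (Phi f M (h / 2) <= (h / y)%:E * Phi f M (y / 2))%E.
Proof.
move=> h0 hy; have y0 : 0 < y by exact: lt_le_trans hy.
apply: ge_ereal_sup => _ [phi phiP <-].
have [cphi phi_ge0 phi0 _] := phiP.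
have t0 : 0 <= h / y by rewrite divr_ge0// ltW.
have t1 : h / y <= 1 by rewrite ler_pdivrMr// mul1r.
have := cphi (Itv01 t0 t1) (y / 2) 0.
rewrite !inE/= !in_itv/= !andbT => /(_ (divr_ge0 (ltW y0) (ler0n _ _)) (lexx 0)).
rewrite !convRE /= phi0 !mulr0 !addr0.
rewrite [X in phi X](_ : _ = h / 2); last first.
  transitivity (h / y * (y / 2) + (1 - h / y) * 0); first by [].
  by field; rewrite gt_eqF.
move=> hh; apply: (@le_trans _ _ ((h / y)%:E * (phi (y / 2))%:E)%E).
  by rewrite -EFinM lee_fin.
by apply: lee_wpmul2l; [rewrite lee_fin|apply: ereal_sup_ubound; exists phi].
Qed.

Lemma Psi_ge0 (x : R) : 0 <= x -> (0 <= Psi f M x)%E.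
Proof. by move=> x0; rewrite mule_ge0// ?lee_fin// Phi_ge0. Qed.

(** One factor y/h comes from the convexity of [Phi], the other from the linear factor in [Psi]. *)
Lemma Psi_scale (h y : R) : 0 < h -> h <= y ->
  (((y / h) ^+ 2)%:E * Psi f M h <= Psi f M y)%E.
Proof.
move=> h0 hy; have y0 : 0 < y by exact: lt_le_trans hy.
have := Phi_le_scale h0 hy.
rewrite /Psi => hP.
apply: (@le_trans _ _ (((y / h) ^+ 2)%:E * (((h / y)%:E * Phi f M (y / 2)) * h%:E))%E).
  apply: lee_wpmul2l; first by rewrite lee_fin sqr_ge0.
  by apply: lee_wpmul2r => //; rewrite lee_fin ltW.
rewrite (muleC _ h%:E) !muleA -!EFinM (muleC (Phi _ _ _)).
by have -> : (y / h) ^+ 2 * h * (h / y) = y by field; rewrite !gt_eqF.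
Qed.

(** Applied to jumps measured in units of h. Smaller jumps count for 0, because the quadratic lower
    bound [Psi_scale] starts at h. *)
Definition big_jump (o : R) : R := if 1 <= o then o ^+ 2 else 0.

Lemma big_jump_ge0 o : 0 <= big_jump o.
Proof. by rewrite /big_jump; case: ifP => // _; exact: sqr_ge0. Qed.

(** Sums [Psi_scale] over the jumps. A single real [W] serves all functions [g], as the covering
    needs one word length for the whole set of solutions. *)
Lemma big_jump_sum (V h : R) : 0 < V -> 0 < h -> Psi f M h != 0%E ->
  exists2 W : R, (V%:E / Psi f M h = W%:E)%E /\ 0 <= W &
    forall g : R -> R, (TV_gen (Psi f M) g <= V%:E)%E ->
    forall (n : nat) (x : nat -> R), (forall i, (i < n)%N -> x i < x i.+1) ->
      \sum_(0 <= i < n) big_jump (`|g (x i.+1) - g (x i)| / h) <= W.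
Proof.
move=> V0 h0 Pn0.
have TVx (g : R -> R) (TV : (TV_gen (Psi f M) g <= V%:E)%E) 
    (n : nat) (x : nat -> R) : (forall i, (i < n)%N -> x i < x i.+1) ->
    (\sum_(0 <= i < n) ((big_jump (`|g (x i.+1) - g (x i)| / h))%:E * Psi f M h) <= V%:E)%E.
  move=> incx; apply: le_trans TV; apply: (@le_trans _ _
    (\sum_(0 <= i < n) Psi f M `|g (x i.+1) - g (x i)|%R)%E); last first.
    by apply: ereal_sup_ubound; exists n, x.
  apply: lee_sum => i _; rewrite /big_jump; case: ifPn => [|_].
    by rewrite ler_pdivlMr// mul1r => ?; exact: Psi_scale.
  by rewrite mul0e Psi_ge0.
have := Psi_ge0 (ltW h0); case: (Psi f M h) Pn0 TVx => [r| |//].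
- rewrite eqe => rn0 TVx; rewrite lee_fin => r_ge0.
  have r0 : 0 < r by rewrite lt_neqAle eq_sym rn0.
  exists (V / r); first by rewrite inver (negbTE rn0) divr_ge0// ltW.
  move=> g TV n x /(TVx g TV); under eq_bigr do rewrite -EFinM.
  by rewrite sumEFin lee_fin -mulr_suml ler_pdivlMr.
(* If [Psi f M h] is infinite, the quotient is 0, and a single jump of size at least h would already
   make the variation infinite. *)
- move=> _ TVx _; exists 0; first by rewrite invey mule0.
  move=> g TV n x /(TVx g TV) h1; rewrite big_seq_cond big1// => i; rewrite andbT => iI.
  apply: contrapT => /eqP bi.
  have bi0 : 0 < big_jump (`|g (x i.+1) - g (x i)| / h).
    by rewrite lt_neqAle eq_sym bi big_jump_ge0.
  have : (V%:E < \sum_(0 <= i < n) ((big_jump (`|g (x i.+1) - g (x i)| / h))%:E * +oo))%E.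
    rewrite (bigD1_seq i) ?iota_uniq//= gt0_muley ?lte_fin//.
    rewrite addye ?ltry// gt_eqF// (lt_le_trans (ltNyr 0))//.
    by apply: sume_ge0 => j _; rewrite mule_ge0// lee_fin big_jump_ge0.
  by rewrite ltNge h1.
Qed.

End Psi.

(** * Integer paths as words on three letters *)

Section codes.

(* The path starts at v; None records the current value and goes to the next cell,
   Some true is a unit step up and Some false a unit step down. *)
Fixpoint decode (v : int) (w : seq (option bool)) : seq int :=
  match w with
  | [::] => [:: v]
  | None :: w' => v :: decode v w'
  | Some b :: w' => decode (if b then v + 1 else v - 1) w'
  end.

(** Padding with [None] repeats the last value, which brings all words to a common length. *)
Lemma decode_stay v m i : (i <= m)%N -> nth 0 (decode v (nseq m None)) i = v.
Proof. by elim: m i => [|m IH] [|i]//= im; exact: IH. Qed.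

Lemma decode_move (d : nat) (v v' : int) w : `|v' - v|%N = d ->
  exists2 s : seq (option bool), size s = d & decode v (s ++ w) = decode v' w.
Proof.
elim: d v => [|d IH] v hd; first by exists [::] => //=; congr decode; lia.
have [vv|vv] := boolP (v <= v').
  have [|s ss sd] := IH (v + 1); first by lia.
  by exists (Some true :: s) => /=; [rewrite ss|].
have [|s ss sd] := IH (v - 1); first by lia.
by exists (Some false :: s) => /=; [rewrite ss|].
Qed.

(** The budget is one [None] per change of cell plus one letter per unit step. The value in the last
    cell is also obtained, since [decode] emits the current value at the end of the word. *)
Lemma encode (n m : nat) (k : nat -> int) :
  (n + \sum_(0 <= i < n) `|k i.+1 - k i| <= m)%N ->
  exists2 w : seq (option bool), size w = m &
    forall i, (i <= n)%N -> nth 0 (decode (k 0%N) w) i = k i.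
Proof.
elim: n m k => [|n IH] m k.
  move=> _; exists (nseq m None); first by rewrite size_nseq.
  by move=> [|//] _; rewrite decode_stay.
rewrite big_nat_recl// => hm.
have [|w sw hw] := IH (m - 1 - `|k 1%N - k 0%N|)%N (fun i => k i.+1); first by lia.
have [s ss hs] := decode_move w (erefl `|k 1%N - k 0%N|%N).
exists (None :: s ++ w); first by rewrite /= size_cat ss sw; lia.
by move=> [//|i] /= im; rewrite hs hw.
Qed.

End codes.

(** * Step functions on a uniform grid *)

Section sampling.
Context {R : realType}.
Local Notation TR := (measurableTypeR R).
Local Notation mu := (@lebesgue_measure R).

Lemma ae_exists (P : R -> Prop) (l r : R) : l < r -> {ae mu, forall x, P x} ->
  exists2 x, l < x < r & P x.
Proof.
move=> lr [N [mN N0 sN]]; apply: contrapT => h.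
have : (mu `]l, r[%classic <= mu N)%E.
  rewrite le_measure ?inE//.
  move=> x /=; rewrite in_itv/= => xlr; apply: sN => /= Px.
  by apply: h; exists x.
by rewrite N0 lebesgue_measure_itv/= lte_fin lr -EFinB lee_fin; lra.
Qed.

(** A mean value argument: the average of [|c - g|] cannot exceed every value by [kap]. The slack
    [kap] makes a non-strict comparison of integrals contradictory. The sample is taken from [g],
    the representative whose variation is controlled pointwise. *)
Lemma cell_sample (u g : R -> R) (l r c kap : R) : l < r -> 0 < kap -> L1 u ->
  {ae mu, forall x, g x = u x} ->
  exists2 z, l < z < r &
    (\int[mu]_(x in `[l, r[) (`|c - u x|)%:E <= ((r - l) * (`|c - g z| + kap))%:E)%E.
Proof.
move=> lr kap0 L1u gu.
have mI : measurable (`[l, r[%classic : set TR) by exact: measurable_itv.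
have mu_ := L1_measurable L1u.
have mcu : measurable_fun (`[l, r[%classic : set TR) (fun x => `|c - u x|).
  by apply: measurable_funTS; apply: measurableT_comp => //; exact: measurable_funB.
have iE y : (\int[mu]_(x in `[l, r[) (cst y%:E x) = (y * (r - l))%:E)%E.
  rewrite integral_cst// /= lebesgue_measure_itv/= lte_fin lr -EFinB -EFinM//.
apply: contrapT => h.
have {}h z : l < z < r ->
    (((r - l) * (`|c - g z| + kap))%:E < \int[mu]_(x in `[l, r[) (`|c - u x|)%:E)%E.
  by move=> zlr; rewrite ltNge; apply/negP => hz; apply: h; exists z.
(* Finiteness turns the average over the cell into a real number. *)
have fin : (\int[mu]_(x in `[l, r[) (`|c - u x|)%:E < +oo)%E.
  apply: (@le_lt_trans _ _ (\int[mu]_(x in `[l, r[) ((cst (`|c|)%:E x) + (`|u x|)%:E))%E).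
    apply: ge0_le_integral => //.
    - exact/measurable_EFinP.
    - apply/measurable_EFinP; apply: measurable_funD => //.
      by apply: measurable_funTS; exact: measurableT_comp.
    - by move=> x _; rewrite -EFinD lee_fin ler_normB.
  rewrite ge0_integralD//; last 2 first.
    by move=> x _; rewrite lee_fin.
    by apply/measurable_EFinP; apply: measurable_funTS; exact: measurableT_comp.
  rewrite [X in (X + _)%E](_ : _ = (`|c| * (r - l))%:E); last exact: iE.
  rewrite lte_add_pinfty ?ltry//.
  move: L1u => /Lfun1_integrable/integrableP[mm]; apply: le_lt_trans.
  rewrite [leRHS](_ : _ = (\int[mu]_x (`|u x|)%:E)%E); last by apply: eq_integral.
  apply: ge0_subset_integral => //.
  by apply/measurable_EFinP; exact: measurableT_comp.
have I0 : (0 <= \int[mu]_(x in `[l, r[) (`|c - u x|)%:E)%E by exact: integral_ge0.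
move: h fin I0; case E : (\int[mu]_(x in `[l, r[) _)%E => [i| |] h //= _ _.
have rl : 0 < r - l by rewrite subr_gt0.
pose m := i / (r - l) - kap.
have hm z : l < z < r -> `|c - g z| < m.
  by move=> /h; rewrite lte_fin /m ltrBrDr ltr_pdivlMr// mulrC.
have m0 : 0 <= m.
  have /hm : l < (l + r) / 2 < r by apply/andP; split; lra.
  by move/ltW; apply: le_trans.
have : (i%:E <= (m * (r - l))%:E)%E.
  rewrite -E -iE; apply: ae_ge0_le_integral => //.
  - exact/measurable_EFinP.
  - apply: ae_imp2 gu (ae_neq l) => x <- /eqP xl; rewrite /= in_itv/= => /andP[lx xr].
    by rewrite lee_fin ltW// hm// xr andbT lt_neqAle eq_sym xl.
rewrite lee_fin /m mulrBl divfK ?gt_eqF//.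
by have := mulr_gt0 kap0 rl; lra.
Qed.

Variables (D h : R).
Hypothesis D_gt0 : 0 < D.

Definition cell_left (n i : nat) : R := - D + i%:R * (2 * D / n.+1%:R).

Definition step_function (n : nat) (k : nat -> int) (x : R) : R :=
  \sum_(0 <= i < n.+1) h * (k i)%:~R * \1_(`[cell_left n i, cell_left n i.+1[%classic) x.

Lemma step_function_L1 n k : L1 (step_function n k).
Proof.
apply/Lfun1_integrable.
have -> : EFin \o step_function n k = (fun x => \sum_(0 <= i < n.+1)
    ((h * (k i)%:~R)%:E * (\1_(`[cell_left n i, cell_left n i.+1[%classic) x)%:E))%E.
  by apply/funext => x /=; rewrite /step_function -sumEFin.
apply: integrable_sum => // i _; apply: integrableZl => //.
exact: integrable_indic_itv.
Qed.

Lemma cell_leftS n i : cell_left n i.+1 = cell_left n i + 2 * D / n.+1%:R.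
Proof. by rewrite /cell_left -natr1; ring. Qed.

Lemma cell_size_gt0 n : 0 < 2 * D / n.+1%:R.
Proof. by rewrite divr_gt0 ?mulr_gt0// ltr0n. Qed.

Lemma cell_left_incr n i : cell_left n i < cell_left n i.+1.
Proof. by rewrite cell_leftS ltrDl cell_size_gt0. Qed.

Lemma cell_left_mono n i j : (i <= j)%N -> cell_left n i <= cell_left n j.
Proof.
move=> ij; rewrite /cell_left lerD2l ler_wpM2r ?ler_nat//.
exact/ltW/cell_size_gt0.
Qed.

Lemma cell_leftT n : cell_left n n.+1 = D.
Proof. by rewrite /cell_left; field; rewrite addrC natr1 pnatr_eq0. Qed.

Lemma cell_cover n x : - D <= x < D ->
  exists2 i, (i < n.+1)%N & cell_left n i <= x < cell_left n i.+1.
Proof.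
move=> /andP[Dx xD].
have [j jn] : exists j, (j < n.+1)%N && (x < cell_left n j.+1).
  by exists n; rewrite ltnSn cell_leftT.
have ex : exists j, x < cell_left n j.+1 by exists j; case/andP : jn.
case: (ex_minnP ex) => i xi imin; exists i.
  by case/andP : jn => jn /imin; lia.
rewrite xi andbT; case: i xi imin => [|i] _ imin.
  by rewrite /cell_left mul0r addr0.
by rewrite leNgt; apply/negP => /imin; lia.
Qed.

Lemma cell_disjoint n i j x : cell_left n i <= x < cell_left n i.+1 ->
  cell_left n j <= x < cell_left n j.+1 -> i = j.
Proof.
move=> /andP[i1 i2] /andP[j1 j2]; apply/eqP; rewrite eqn_leq (leqNgt i) (leqNgt j).
apply/andP; split; apply/negP => /(cell_left_mono n) hij.
  by have := lt_le_trans j2 (le_trans hij i1); rewrite ltxx.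
by have := lt_le_trans i2 (le_trans hij j1); rewrite ltxx.
Qed.

Lemma step_function_d_L1 n k (u : R -> R) : L1 u ->
  {ae mu, forall x, D < `|x| -> u x = 0} ->
  (d_L1 (step_function n k) u <= \sum_(0 <= i < n.+1)
    \int[mu]_(x in `[cell_left n i, cell_left n i.+1[) (`|h * (k i)%:~R - u x|)%:E)%E.
Proof.
move=> L1u u0.
have mu_ := L1_measurable L1u.
pose I i := `[cell_left n i, cell_left n i.+1[%classic : set TR.
have mI i : measurable (I i) by exact: measurable_itv.
under eq_bigr do rewrite integral_mkcond.
pose F i := ((fun x => (`|h * (k i)%:~R - u x|)%:E) \_ (I i)).
have mF i : measurable_fun (setT : set TR) (F i).
  apply: (measurable_restrictT _ (mI i)).1; apply/measurable_EFinP.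
  by apply: measurable_funTS; apply: measurableT_comp => //; exact: measurable_funB.
have F0 i x : (0 <= F i x)%E by apply: erestrict_ge0.
rewrite [leRHS](_ : _ = (\int[mu]_x (\sum_(0 <= i < n.+1) F i x))%E); last first.
  by rewrite ge0_integral_sum.
rewrite d_L1E.
apply: ae_ge0_le_integral => //.
- apply/measurable_EFinP; apply: measurableT_comp => //.
  by apply: measurable_funB => //; apply: L1_measurable; exact: step_function_L1.
- by move=> x _; apply: sume_ge0 => i _; exact: F0.
- by apply: emeasurable_sum => i; exact: mF.
(* The cells cover only the half-open [-D, D), and [u] is known to vanish only for [D < |x|]. *)
have nDD : {ae mu, forall x, x <> D} := ae_neq D.
apply: ae_imp2 u0 nDD => x ux xD _.
have [xin|xout] := boolP (- D <= x < D).
  have [i iN xi] := cell_cover n xin.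
  have inI : x \in I i by rewrite inE /I /= in_itv.
  have notin j : j != i -> x \in I j = false.
    move=> ji; apply/negP; rewrite inE /I /= in_itv/= => xj.
    by move: ji; rewrite (cell_disjoint xj xi) eqxx.
  have iin : i \in index_iota 0 n.+1 by rewrite mem_index_iota.
  have -> : step_function n k x = h * (k i)%:~R.
    rewrite /step_function (bigD1_seq i iin (iota_uniq _ _)) indicE -/(I i) inI mulr1.
    by rewrite big1 => [|j ji]; [exact: addr0|]; rewrite indicE -/(I j) notin// mulr0.
  rewrite (bigD1_seq i iin (iota_uniq _ _)) /F patchE inI; apply: leeDl.
  by apply: sume_ge0 => j _; exact: F0.
have -> : step_function n k x = 0.
  rewrite /step_function big_nat_cond big1// => i; rewrite andbT => /andP[_ iN].
  rewrite indicE (_ : x \in _ = false) ?mulr0//; apply/negP; rewrite inE/= in_itv/= => /andP[h1 h2].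
  move/negP: xout; apply; apply/andP; split.
    by apply: le_trans h1; rewrite -[leLHS](_ : cell_left n 0 = _) ?cell_left_mono// /cell_left mul0r addr0.
  by apply: (lt_le_trans h2); rewrite -[leRHS](cell_leftT n) cell_left_mono.
rewrite ux ?subr0 ?normr0; first by apply: sume_ge0 => j _; exact: F0.
move: xout; rewrite negb_and -ltNge -leNgt => /orP[xl|xl].
  by have := ler_norm (- x); rewrite normrN; lra.
by rewrite (lt_le_trans _ (ler_norm _))// lt_neqAle xl andbT; apply/eqP => e; exact: xD.
Qed.

End sampling.

(** * Rounding, and the coded approximation of a sampled solution *)

Section coding.
Context {R : realType}.
Local Notation mu := (@lebesgue_measure R).

Definition round (y : R) : int := Num.floor (y + 2^-1).

Lemma round_bounds (y : R) : y - 2^-1 < (round y)%:~R <= y + 2^-1.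
Proof.
have := floor_itv (y + 2^-1); rewrite -/(round y) intrD => /andP[h1 h2].
by rewrite h1 andbT; lra.
Qed.

Lemma round0 : round 0 = 0.
Proof. by rewrite /round; apply/eqP; rewrite floor_eq; apply/andP; split; lra. Qed.

Lemma round_dist (y : R) : `|(round y)%:~R - y| <= 2^-1.
Proof.
by have /andP[? ?] := round_bounds y; rewrite ler_norml; apply/andP; split; lra.
Qed.

(** Rounding changes a distance by less than 1. A distance o < 1 gives an integer below 2, hence at
    most 1; if o >= 1 then o + 1 <= 1 + o^2. *)
Lemma round_jump (y z : R) : `|round y - round z|%N%:R <= 1 + big_jump `|y - z|.
Proof.
have h : `|round y - round z|%N%:R < `|y - z| + 1.
  have -> : `|round y - round z|%N%:R = `|(round y)%:~R - (round z)%:~R : R|.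
    by rewrite -intrB -intr_norm pmulrn abszE.
  have /andP[? ?] := round_bounds y; have /andP[? ?] := round_bounds z.
  have := ler_norm (y - z); have := ler_norm (- (y - z)); rewrite normrN => ? ?.
  by rewrite ltr_norml; apply/andP; split; lra.
rewrite /big_jump; case: ifPn => [ge1|]; last rewrite -ltNge => o1.
  by apply: (le_trans (ltW h)); move: (`|y - z|) ge1 => o ge1; nra.
rewrite addr0 -[1]/(1%:R) ler_nat -ltnS -(ltr_nat R).
by apply: (lt_le_trans h); lra.
Qed.

(** For a large jump this is (o - 2)^2 >= 0. *)
Lemma le_big_jump (o : R) : o <= 1 + big_jump o / 4.
Proof.
rewrite /big_jump; case: ifPn => [ge1|]; last by rewrite -ltNge; lra.
by have := sqr_ge0 (o - 2); nra.
Qed.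

(** Along an interleaved sequence, it keeps the jumps inside the cells and discards those between
    consecutive cells. *)
Lemma sum_even_le (F : nat -> R) (m : nat) : (forall j, 0 <= F j) ->
  \sum_(0 <= i < m) F i.*2 <= \sum_(0 <= j < m.*2) F j.
Proof.
move=> F0; elim: m => [|m IH]; first by rewrite !big_geq.
rewrite doubleS big_nat_recr//= big_nat_recr//= big_nat_recr//=.
by have := F0 m.*2.+1; lra.
Qed.

(** With n the integer part of W there are n + 1 > W cells, so the large jumps contribute less than
    D h / 2 to the error. The rest contributes 13/4 D h, and the total stays below 4 D h. *)
Lemma sampling_code (D h W : R) (g u : R -> R) : 0 < D -> 0 < h -> 0 <= W ->
  L1 u -> {ae mu, forall x, g x = u x} ->
  {ae mu, forall x, D < `|x| -> u x = 0} ->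
  (forall (n : nat) (x : nat -> R), (forall i, (i < n)%N -> x i < x i.+1) ->
      \sum_(0 <= i < n) big_jump (`|g (x i.+1) - g (x i)| / h) <= W) ->
  let n := Num.trunc W in
  exists k : nat -> int, [/\ k 0%N = 0,
    (n + \sum_(0 <= i < n) `|k i.+1 - k i| <= 3 * n)%N &
    (d_L1 (step_function D h n k) u < (4 * D * h)%:E)%E].
Proof.
move=> D0 h0 W0 L1u gu u0 HV n.
have /andP[nW Wn] := truncn_itv W0; rewrite -/n in nW Wn.
have cl0 : cell_left D n 0 = - D by rewrite /cell_left mul0r addr0.
have clS := cell_left_incr D0 n.
(* g vanishes at some p to the left of the support: taken as the sample of the first
   cell, it makes the coded path start at 0. *)
have [p /andP[_ pD] [gp up]] : exists2 x, - D - 1 < x < - D &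
    g x = u x /\ (D < `|x| -> u x = 0).
  apply: ae_exists; first by lra.
  exact: ae_imp2 gu u0.
have gp0 : g p = 0.
  by rewrite gp up//; have := ler_norm (- p); rewrite normrN; lra.
pose X i := if i is 0%N then p else cell_left D n i.
have XS i : X i < X i.+1.
  by case: i => [|i] /=; [rewrite (lt_trans pD)// -cl0|]; exact: clS.
have Xle i : X i <= cell_left D n i by case: i => [|i] //=; rewrite cl0 ltW.
pose k i := round (g (X i) / h).
have h8 : 0 < h / 8 by lra.
have /choice[z zP] : forall i, exists z, cell_left D n i < z < cell_left D n i.+1 /\
    (\int[mu]_(x in `[cell_left D n i, cell_left D n i.+1[) (`|h * (k i)%:~R - u x|)%:E <=
      ((cell_left D n i.+1 - cell_left D n i) * (`|h * (k i)%:~R - g z| + h / 8))%:E)%E.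
  by move=> i; have [z z1 z2] := cell_sample (h * (k i)%:~R) (clS i) h8 L1u gu; exists z.
exists k; split.
- by rewrite /k /= gp0 mul0r round0.
(* The variation is at most n + W < 2 n + 1 by [round_jump]; being an integer, it is at most 2 n. *)
- have -> : (3 * n = n + 2 * n)%N by lia.
  rewrite leq_add2l -ltnS -(ltr_nat R) natr_sum.
  have := HV n X (fun i _ => XS i) => HX.
  apply: (@le_lt_trans _ _ (\sum_(0 <= i < n) (1 + big_jump (`|g (X i.+1) - g (X i)| / h)))).
    apply: ler_sum => i _; apply: le_trans (round_jump _ _) _.
    by rewrite -mulrBl normrM (@ger0_norm _ h^-1) ?invr_ge0 ?(ltW h0).
  rewrite big_split/= sumr_const_nat subn0.
  have -> : (2 * n).+1%:R = n%:R + n.+1%:R :> R by rewrite -natrD; congr (_%:R); lia.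
  by apply: ler_ltD => //; exact: le_lt_trans HX Wn.
apply: (le_lt_trans (@step_function_d_L1 _ D h D0 n k u L1u u0)).
apply: (@le_lt_trans _ _ (\sum_(0 <= i < n.+1)
  ((2 * D / n.+1%:R) * (`|h * (k i)%:~R - g (z i)| + h / 8))%:E)%E).
  apply: lee_sum => i _; have [_ +] := zP i.
  by rewrite [cell_left D n i.+1 - _](_ : _ = 2 * D / n.+1%:R)// cell_leftS addrC addKr.
rewrite sumEFin lte_fin -mulr_sumr.
(* interleaved, the sample points X i and the points z i are increasing *)
pose Y j := if odd j then z j./2 else X j./2.
have YS j : Y j < Y j.+1.
  rewrite /Y /= uphalf_half; case: (boolP (odd j)) => oj /=.
    have [/andP[_ +] _] := zP j./2; rewrite add1n => zj.
    by apply: (lt_le_trans zj).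
  have [/andP[+ _] _] := zP j./2; rewrite add0n => zj.
  exact: le_lt_trans (Xle _) zj.
have HY := HV n.+1.*2 Y (fun i _ => YS i).
have {}HY : \sum_(0 <= i < n.+1) big_jump (`|g (z i) - g (X i)| / h) <= W.
  apply: le_trans HY.
  apply: le_trans (sum_even_le n.+1 (fun j => big_jump_ge0 (`|g (Y j.+1) - g (Y j)| / h))).
  by apply: ler_sum => i _; rewrite /Y /= odd_double /= uphalf_double doubleK.
(* Here 13/8 is 1/2 for the rounding, 1 from [le_big_jump], and 1/8 for the slack in
   [cell_sample]. *)
have bound i : `|h * (k i)%:~R - g (z i)| + h / 8 <=
    h * (13 / 8 + big_jump (`|g (z i) - g (X i)| / h) / 4).
  have h1 : `|h * (k i)%:~R - g (X i)| <= h / 2.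
    have -> : h * (k i)%:~R - g (X i) = h * ((k i)%:~R - g (X i) / h).
      by field; rewrite gt_eqF.
    by rewrite normrM (gtr0_norm h0) ler_wpM2l ?(ltW h0)//; exact: round_dist.
  have h2 := le_big_jump (`|g (z i) - g (X i)| / h).
  rewrite ler_pdivrMr// in h2.
  have h3 : `|h * (k i)%:~R - g (z i)| <= `|h * (k i)%:~R - g (X i)| + `|g (z i) - g (X i)|.
    rewrite (distrC (g (z i))).
    have -> : h * (k i)%:~R - g (z i) =
      (h * (k i)%:~R - g (X i)) + (g (X i) - g (z i)) by ring.
    exact: ler_normD.
  by move: h1 h2 h3; move: (`|g (z i) - g (X i)|) (big_jump _) => o B; lra.
have step1 : \sum_(0 <= i < n.+1) (`|h * (k i)%:~R - g (z i)| + h / 8) <=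
    h * (13 / 8 * n.+1%:R + W / 4).
  apply: (le_trans (ler_sum _ (fun i _ => bound i))).
  rewrite -mulr_sumr big_split/= sumr_const_nat subn0 -mulr_suml ler_wpM2l ?(ltW h0)//.
  by rewrite mulr_natr lerD2l ler_wpM2r.
have N0 : 0 < n.+1%:R :> R by rewrite ltr0n.
apply: (@le_lt_trans _ _ (2 * D / n.+1%:R * (h * (13 / 8 * n.+1%:R + W / 4)))).
  by rewrite ler_wpM2l// divr_ge0 ?mulr_ge0 ?(ltW D0).
move: N0 Wn; move: (n.+1%:R) => N N0 WN.
have -> : 2 * D / N * (h * (13 / 8 * N + W / 4)) = (D * h) * (13 / 4 + W / N / 2).
  by field; rewrite gt_eqF.
have WN1 : W / N < 1 by rewrite ltr_pdivrMr// mul1r.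
have Dh : 0 < D * h by rewrite mulr_gt0.
rewrite (_ : 4 * D * h = D * h * 4); last by ring.
by rewrite ltr_pM2l//; lra.
Qed.

End coding.

(** * Covering numbers *)

Lemma covering_number_le_card (R : realType) (T : Type) (X : set T)
    (d : T -> T -> \bar R) (K : set T) (eps : R) (F : finType) (c : F -> T) :
  (forall i, X (c i)) -> K `<=` X ->
  (forall y, K y -> exists i, (d (c i) y < eps%:E)%E) ->
  (covering_number X d K eps <= #|F|%:R%:E)%E.
Proof.
move=> Xc KX dK; apply: ereal_inf_lbound; exists #|F| => //=.
exists (fun i => c (enum_val i)); split => [i|y Ky]; first exact: Xc.
have [i di] := dK y Ky; exists (enum_rank i) => //=.
by split; [exact: KX|rewrite enum_rankK].
Qed.

Lemma metric_entropy_le (R : realType) (T : Type) (X : set T)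
    (d : T -> T -> \bar R) (K : set T) (eps : R) (N : nat) : (0 < N)%N ->
  (covering_number X d K eps <= N%:R%:E)%E ->
  (metric_entropy X d K eps <= (log2 N%:R)%:E)%E.
Proof.
move=> N0 hN; rewrite /metric_entropy /log2.
have l2 : 0 < ln 2 :> R by rewrite ln_gt0// ltr1n.
have c0 : (0 <= covering_number X d K eps)%E.
  by apply: le_ereal_inf_tmp => _ [m _ <-]; rewrite lee_fin.
rewrite EFinM inver gt_eqF//; apply: lee_wpmul2r; first by rewrite lee_fin invr_ge0 ltW.
have N0' : 0 < N%:R :> R by rewrite ltr0n.
rewrite -(lne_EFin N0') lee_lne// in_itv/= ?c0 ?leey//.
by rewrite lee_fin ltW//= leey.
Qed.

(** * The entropy estimate, from the number of words *)

Theorem theorem3p7 (R : realType) (f : R -> R) (L M gamma T : R)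
    (S : R -> (R -> R) -> R -> R)
    (f_C2 : C2_function f)
    (f_nonlinear : dense [set u : R | f^`()^`() u != 0])
    (L_gt0 : 0 < L) (M_gt0 : 0 < M) (T_gt0 : 0 < T)
    (S_semigroup : entropy_semigroup f S)
    (gamma_constant : regularity_constant f S L M gamma) :
  exists2 eps0 : R, 0 < eps0 &
    forall eps : R, 0 < eps -> eps <= eps0 ->
      (metric_entropy L1 d_L1 (S T @` initial_data L M) eps <=
       (log2 (16 * M * (L + T * max_speed f M) / eps + 1))%:E +
       (2 * (3 * log2 5 + log2 (5 * expR 1)))%:E *
       ((gamma * (1 + T^-1))%:E /
        Psi f M (eps / (4 * L + 4 * T * max_speed f M))))%E.
Proof.
exists 1 => // eps eps0 _.
have ms0 := max_speed_ge0 f_C2 (ltW M_gt0).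
set D := L + T * max_speed f M.
have D0 : 0 < D by rewrite ltr_pwDl// mulr_ge0// ltW.
set h := eps / _.
have hE : h = eps / (4 * D) by rewrite /h /D; congr (_ / _); ring.
have h0 : 0 < h by rewrite hE divr_gt0// mulr_gt0.
have Dh : 4 * D * h = eps by rewrite hE; field; rewrite gt_eqF.
case: gamma_constant => gamma0 reg.
set V := gamma * (1 + T^-1).
have V0 : 0 < V by rewrite mulr_gt0// addr_gt0// invr_gt0.
have l2 : 0 < ln 2 :> R by rewrite ln_gt0// ltr1n.
have l5 : 0 < ln 5 :> R by rewrite ln_gt0// ltr1n.
have log5 : 0 < log2 (5 : R) by rewrite divr_gt0.
have log5e : 0 <= log2 (5 * expR 1 : R).
  by rewrite divr_ge0 ?(ltW l2)// lnM ?posrE ?expR_gt0// expRK addr_ge0// ltW.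
set c := 2 * _.
have c0 : 0 < c by rewrite /c; lra.
(* All coded paths start at 0, so no starting value has to be counted and the logarithmic term is
   bounded below by 0. *)
have lg0 : 0 <= log2 (16 * M * D / eps + 1).
  rewrite divr_ge0 ?(ltW l2)// ln_ge0// lerDr divr_ge0 ?(ltW eps0)//.
  by rewrite !mulr_ge0// ltW.
(* x / 0 is +oo in the extended reals *)
have [P0|Pn0] := eqVneq (Psi f M h) 0%E.
  by rewrite P0 inve0 gt0_muley ?lte_fin// gt0_muley ?lte_fin// addey// leey.
have data u0 : initial_data L M u0 ->
    L1 (S T u0) /\ {ae @lebesgue_measure R, forall x, D < `|x| -> S T u0 x = 0}.
  move=> u0P.
  have sol := S_semigroup u0 (initial_data_L1 L_gt0 u0P) (let: And3 H _ _ := u0P in H).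
  split; first exact: (entropy_solution_L1 sol (ltW T_gt0)).
  exact: (finite_propagation_speed f_C2 sol (ltW M_gt0) (initial_data_le u0P) T_gt0
    (initial_data_support u0P)).
have [W [WE W0] HW] := big_jump_sum V0 h0 Pn0.
rewrite WE -EFinM -EFinD.
set n := Num.trunc W.
have nW : n%:R <= W by have /andP[] := truncn_itv W0.
(* One centre per word of length 3 n on three letters, decoded from the value 0. *)
pose center (w : (3 * n).-tuple (option bool)) :=
  step_function D h n (fun i => nth 0 (decode 0 w) i).
have cov : (covering_number L1 d_L1 (S T @` initial_data L M) eps <=
    #|{: (3 * n).-tuple (option bool)}|%:R%:E)%E.
  apply: (@covering_number_le_card _ _ _ _ _ _ _ center).
  - by move=> w; exact: step_function_L1.
  - by move=> _ [u0 /data[+ _] <-].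
  - move=> _ [u0 u0P <-]; have [L1u supp] := data _ u0P.
    have [g gu TVg] := reg T u0 T_gt0 u0P.
    have [k [k0 kn kd]] := sampling_code D0 h0 W0 L1u gu supp (HW g TVg).
    have [w sw wk] := encode kn.
    have sw' : size w == (3 * n)%N by rewrite sw.
    exists (Tuple sw'); rewrite -Dh; apply: le_lt_trans kd.
    rewrite (_ : center _ = step_function D h n k)//; apply/funext => x.
    rewrite /center /step_function; apply: eq_big_nat => i /andP[_ iN].
    by have := wk i; rewrite k0 => ->.
apply: (le_trans (metric_entropy_le _ cov)).
  by rewrite card_tuple card_option card_bool expn_gt0.
rewrite card_tuple card_option card_bool lee_fin.
have -> : log2 (3 ^ (3 * n))%:R = (3 * n%:R) * log2 (3 : R).
  by rewrite /log2 natrX lnXn ?ltr0n// -[_ *+ _]mulr_natl natrM; ring.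
(* The count gives 3 n log2 3 <= 3 W log2 5, and the constant [c] exceeds 3 log2 5. *)
have l35 : log2 (3 : R) <= log2 5.
  by rewrite /log2 ler_wpM2r ?invr_ge0 ?(ltW l2)// ler_ln ?posrE// ler_nat.
have : 3 * n%:R * log2 3 <= 3 * n%:R * log2 (5 : R) by rewrite ler_wpM2l// mulr_ge0.
have : 3 * n%:R * log2 (5 : R) <= 3 * W * log2 5.
  by rewrite ler_wpM2r ?(ltW log5)// ler_wpM2l.
have : 3 * W * log2 5 <= c * W.
  by rewrite /c mulrAC ler_wpM2r//; lra.
lra.
Qed.
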